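(* Let $A$ be a representation-infinite Artin algebra with postprojective partition $\{\mathbf{P}_i\}_{i\in\mathbb{N}_\infty}$. If $\Gamma$ is a $\mathbf{P}$-discrete connected component of the Auslander-Reiten quiver $\Gamma_A$, then there is no arrow $M \rightarrow N$ in $\Gamma$ with $M \in \mathbf{P}_i$ and $N \in \mathbf{P}_j$ such that $i+1<j<\infty$.
   Context: All algebras are assumed basic. For an Artin algebra $A$, $\mathrm{mod}A$ is the category of finitely generated left $A$-modules, $\mathrm{ind}A$ is the full subcategory consisting of one representative of each isomorphism class of indecomposable modules, and $\Gamma_A$ is the Auslander-Reiten quiver of $A$. Postprojective partition (Auslander-Smalø): write $\mathbb{N}_\infty=\mathbb{N}\cup\{\infty\}$ with $0\in\mathbb{N}$. A postprojective partition of $A$ is a partition $\{\mathbf{P}_i\}_{i\in\mathbb{N}_\infty}$ of $\mathrm{ind}A$ such that (a) $\mathrm{ind}A$ is the disjoint union of the subcategories $\mathbf{P}_i$, $i\in\mathbb{N}_\infty$; (b) for each $j<\infty$, $\mathbf{P}_j$ is a finite minimal cover of $\bigcup_{j\le i\le\infty}\mathbf{P}_i$. Here a subcategory $\mathcal{D}\subseteq\mathcal{C}$ is a cover of $\mathcal{C}$ if every module in $\mathcal{C}$ is an epimorphic image of a module in $\mathrm{add}\,\mathcal{D}$, and it is minimal if no proper subcategory of $\mathcal{D}$ is a cover of $\mathcal{C}$. Every Artin algebra has a unique such partition, and $\mathbf{P}_0$ consists of the indecomposable projectives. Modules in $\mathrm{add}\,\mathbf{P}$, where $\mathbf{P}=\bigcup_{0\le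 i<\infty}\mathbf{P}_i$, are called postprojective. For $i\in\mathbb{N}_\infty$ and $M\in\mathrm{mod}A$, the trace $\mathrm{tr}_{\mathbf{P}_i}(M)$ is the submodule of $M$ generated by the images of all morphisms $N\to M$ with $N\in\mathbf{P}_i$. For $A$ representation-infinite, a connected component $\Gamma$ of $\Gamma_A$ is $\mathbf{P}$-discrete if for every integer $i\ge 0$ and every $M\in\Gamma\cap\mathbf{P}_i$ one has $\mathrm{tr}_{\mathbf{P}_{i+1}}(M)=\mathrm{tr}_{\mathbf{P}_\infty}(M)$. *)

(* Defs.v *)
From HB Require Import structures.
From Stdlib Require Import Relation_Operators.
From mathcomp Require Import all_boot all_algebra.
From mathcomp Require Import boolp classical_sets functions cardinality.

Set Implicit Arguments.
Unset Strict Implicit.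
Unset Printing Implicit Defensive.

Import GRing.Theory.
Local Open Scope classical_set_scope.
Local Open Scope ring_scope.

(* Left A-modules are [lmodType A] and A-linear maps are [{linear M -> N}];
   [A^o] is A as a left module over itself. *)

Definition submodule (A : pzRingType) (M : lmodType A) (S : set M) : Prop :=
  S 0 /\ forall (a : A) (u v : M), S u -> S v -> S (a *: u + v).

Definition fin_gen (A : pzRingType) (M : lmodType A) : Prop :=
  exists (n : nat) (g : 'I_n -> M),
    forall x : M, exists c : 'I_n -> A, x = \sum_(i < n) c i *: g i.

Definition iso_mod (A : pzRingType) (M N : lmodType A) : Prop :=
  exists f : {linear M -> N}, bijective f.

Definition zero_mod (A : pzRingType) (M : lmodType A) : Prop :=
  forall x : M, x = 0.

Definition indecomposable (A : pzRingType) (M : lmodType A) : Prop :=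
  ~ zero_mod M /\
  forall X Y : lmodType A,
    iso_mod M ((X * Y)%type : lmodType A) -> zero_mod X \/ zero_mod Y.

(* Finite direct sum F 0 x (F 1 x (... x 0)); the zero module is 'rV_0. *)
Definition dirsum (A : pzRingType) (n : nat) (F : 'I_n -> lmodType A) :
    lmodType A :=
  \big[(fun M N : lmodType A => (M * N)%type : lmodType A)
       / ('rV[A]_0 : lmodType A)]_(i < n) F i.

Definition artinian (R : comPzRingType) : Prop :=
  forall J : nat -> set R^o,
    (forall n, submodule (J n)) ->
    (forall n, J n.+1 `<=` J n) ->
    exists n, forall m, (n <= m)%N -> J m = J n.

Definition artin_algebra (R : comPzRingType) (A : algType R) : Prop :=
  artinian R /\ fin_gen (A : lmodType R).

Definition basic (A : pzRingType) : Prop :=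
  exists (n : nat) (Q : 'I_n -> lmodType A),
    [/\ forall i, indecomposable (Q i),
        forall i j, iso_mod (Q i) (Q j) -> i = j
      & iso_mod (A^o : lmodType A) (dirsum Q)].

(* ind A: a choice of one representative of each isomorphism class of finitely
   generated indecomposable modules. Full subcategories of ind A are then sets
   of indices. *)
Record indcat (A : pzRingType) := IndCat {
  ind_obj :> Type;
  ind_mod : ind_obj -> lmodType A;
  ind_fin_gen : forall X, fin_gen (ind_mod X);
  ind_indecomposable : forall X, indecomposable (ind_mod X);
  ind_skeletal : forall X Y, iso_mod (ind_mod X) (ind_mod Y) -> X = Y;
  ind_dense : forall M : lmodType A, fin_gen M -> indecomposable M ->
    exists X, iso_mod M (ind_mod X)
}.

Definition rep_infinite (A : pzRingType) (I : indcat A) : Prop :=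
  infinite_set [set: I].

Definition split_mono (A : pzRingType) (M N : lmodType A)
  (f : {linear M -> N}) : Prop := exists g : {linear N -> M}, cancel f g.

Definition split_epi (A : pzRingType) (M N : lmodType A)
  (f : {linear M -> N}) : Prop := exists g : {linear N -> M}, cancel g f.

Definition irreducible_map (A : pzRingType) (M N : lmodType A)
    (f : {linear M -> N}) : Prop :=
  [/\ ~ split_mono f, ~ split_epi f
    & forall (X : lmodType A) (g : {linear M -> X}) (h : {linear X -> N}),
        fin_gen X -> (forall x, f x = h (g x)) -> split_mono g \/ split_epi h].

(* Arrows of the Auslander-Reiten quiver, whose vertex set is I; valuations of
   the arrows are not recorded. *)
Definition AR_arrow (A : pzRingType) (I : indcat A) (M N : I) : Prop :=
  exists f : {linear ind_mod M -> ind_mod N}, irreducible_map f.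

Definition AR_component (A : pzRingType) (I : indcat A) (G : set I) : Prop :=
  exists M : I, G = [set N | clos_refl_sym_trans I (@AR_arrow A I) M N].

Definition in_add (A : pzRingType) (I : indcat A) (D : set I)
    (X : lmodType A) : Prop :=
  exists (n : nat) (F : 'I_n -> I),
    (forall k, D (F k)) /\
    exists s : {linear X -> dirsum (fun k => ind_mod (F k))}, split_mono s.

Definition is_cover (A : pzRingType) (I : indcat A) (D C : set I) : Prop :=
  D `<=` C /\
  forall M : I, C M ->
    exists X : lmodType A, in_add D X /\
      exists f : {linear X -> ind_mod M}, set_surj [set: X] [set: ind_mod M] f.

Definition minimal_cover (A : pzRingType) (I : indcat A) (D C : set I) : Prop :=
  is_cover D C /\ forall D' : set I, D' `<` D -> ~ is_cover D' C.

Inductive natinf : Type := Fin of nat | Infty.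

Definition le_natinf (j : nat) (i : natinf) : Prop :=
  if i is Fin k then (j <= k)%N else True.

Definition postprojective_partition (A : pzRingType) (I : indcat A)
    (P : natinf -> set I) : Prop :=
  [/\ trivIset [set: natinf] P,
      \bigcup_(i in [set: natinf]) P i = [set: I]
    & forall j : nat,
        finite_set (P (Fin j)) /\
        minimal_cover (P (Fin j)) (\bigcup_(i in [set i | le_natinf j i]) P i)].

Definition trace (A : pzRingType) (I : indcat A) (D : set I)
    (M : lmodType A) : set M :=
  smallest (@submodule A M)
    [set y | exists (N : I) (f : {linear ind_mod N -> M}) (x : ind_mod N),
       D N /\ f x = y].
Arguments trace {A I} D M _.

Definition P_discrete (A : pzRingType) (I : indcat A) (P : natinf -> set I)
    (G : set I) : Prop :=
  forall (i : nat) (M : I), G M -> P (Fin i) M ->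
    trace (P (Fin i.+1)) (ind_mod M) = trace (P Infty) (ind_mod M).

(* Main.v *)
(* Let M -> N be an arrow with M in P_i, N in P_j and i+1 < j, and let
   0 -> K -> E -> N -> 0 be the almost split sequence ending at N. Maps from
   P_{i+1} to N factor through E, and P-discreteness makes their component in
   the summand M of E land in tr_{P_oo}(M); since P_{i+1} generates N, it
   follows that M = tr_{P_oo}(M) + im(K -> M). But no module of P_i is a sum of
   images of non-isomorphisms from the layers P_k, k >= i, so K lies in P_l for
   some l < i. In the same way some summand L of E lies in P_{j-1}: otherwise N
   would be a sum of images of non-isomorphisms from layers P_k, k >= j. Thus
   K -> L is an arrow from P_l to P_{j-1} with l+1 < j-1, and induction on i
   applies.

   Almost split sequences are obtained without duality. Among the pairs (Z, xi)
   where xi in Ext^1(N, Z) is nonzero but vanishes in every proper quotient of Z,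
   the length of Z over R is bounded; a pair with Z of maximal length gives an
   almost split sequence. *)
From HB Require Import structures.
From Stdlib Require Import Relation_Operators.
Require Import Defs.
From mathcomp Require Import all_boot all_algebra.
From mathcomp Require Import boolp classical_sets functions cardinality.

Set Implicit Arguments.
Unset Strict Implicit.
Unset Printing Implicit Defensive.

Import GRing.Theory.
Local Open Scope classical_set_scope.
Local Open Scope ring_scope.

(** * Submodules, quotients and linear maps *)

(** Finiteness is extracted from length alone. Lengths are compared rather than computed: the
    bounded, strictly monotone number of [ranked] yields maximal and minimal submodules and bounds
    strict chains. By Fitting's lemma the non-bijective endomorphisms of an indecomposable of finite
    length are closed under sums and under composition with any endomorphism. So non-bijectivity can
    play the part of membership in the radical, and if the identity of such a module is a finite sum
    of endomorphisms, one of them is bijective; this is what places M among the summands of E. The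
    two halves of almost splitness arise differently. Maximality of Z controls the maps out of K; a
    map into N is handled by pulling the sequence back along it and iterating an induced
    endomorphism of N. The gap i+1 < j makes the layers i+1 and j distinct, so that maps from
    P_{i+1} to N are not split and factor through E. It is inherited by the new pair because l+1 <=
    i < j-1. The induction is strong, so i = 0 is covered: no l is left below it. *)

Definition linear_of (A : pzRingType) (M N : lmodType A) (f : M -> N)
    (lf : linear f) : {linear M -> N} :=
  HB.pack f (GRing.isLinear.Build A M N *:%R f lf).

Lemma linear_ofE (A : pzRingType) (M N : lmodType A) (f : M -> N)
  (lf : linear f) x : linear_of lf x = f x.
Proof. by []. Qed.

(** A relation closed under linear combinations whose fibre over 0 is trivial is single-valued, so
    any choice function for it is automatically linear. This produces maps out of quotients and into
    submodules without formulas. *)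
Lemma linear_relation (A : pzRingType) (M N : lmodType A) (F : M -> N -> Prop) :
  (forall x, exists y, F x y) ->
  (forall a x y x' y', F x y -> F x' y' -> F (a *: x + x') (a *: y + y')) ->
  (forall y, F 0 y -> y = 0) ->
  exists h : {linear M -> N}, forall x, F x (h x).
Proof.
move=> tot lin0 inj0.
have uniq x y y' : F x y -> F x y' -> y = y'.
  move=> h h'; have := lin0 (-1) _ _ _ _ h h'.
  rewrite !scaleN1r addNr => /inj0 /eqP.
  by rewrite addrC subr_eq0 => /eqP.
have [f hf] := choice tot.
have lf : linear f.
  by move=> a x y; apply: (uniq (a *: x + y)); [apply: hf | apply: lin0].
by exists (linear_of lf).
Qed.

Section Submodules.
Variables (A : pzRingType) (M : lmodType A).
Implicit Types S T : set M.

Lemma submodule0 S : submodule S -> S 0. Proof. by case. Qed.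
Lemma submoduleD S x y : submodule S -> S x -> S y -> S (x + y).
Proof. by move=> [_ h] hx hy; have := h 1 _ _ hx hy; rewrite scale1r. Qed.
Lemma submoduleZ S a x : submodule S -> S x -> S (a *: x).
Proof. by move=> [h0 h] hx; have := h a _ _ hx h0; rewrite addr0. Qed.
Lemma submoduleN S x : submodule S -> S x -> S (- x).
Proof. by move=> h hx; rewrite -scaleN1r; apply: submoduleZ. Qed.
Lemma submoduleB S x y : submodule S -> S x -> S y -> S (x - y).
Proof. by move=> h hx hy; apply: submoduleD => //; apply: submoduleN. Qed.
Lemma submodule_sum S (J : Type) (r : seq J) (Q : pred J) (F : J -> M) :
  submodule S -> (forall i, Q i -> S (F i)) -> S (\sum_(i <- r | Q i) F i).
Proof.
move=> h hF; apply: (big_ind S) => //; first exact: submodule0.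
by move=> x y; apply: submoduleD.
Qed.

Lemma smallest_sub (G : set M) S :
  submodule S -> G `<=` S -> smallest (@submodule A M) G `<=` S.
Proof. by move=> h hG x /(_ S); apply. Qed.

Lemma smallest_gen (G : set M) : G `<=` smallest (@submodule A M) G.
Proof. by move=> x hx S [_ hS]; apply: hS. Qed.

Lemma submodule_smallest (G : set M) : submodule (smallest (@submodule A M) G).
Proof.
split=> [S [hS _]|a u v hu hv S hS]; first exact: submodule0.
by apply: hS.1.2; [apply: hu | apply: hv].
Qed.
End Submodules.

Section Linear.
Variables (A : pzRingType) (M N : lmodType A) (f : {linear M -> N}).

Lemma submodule_preim (S : set N) : submodule S -> submodule (f @^-1` S).
Proof.
move=> h; split=> [|a u v hu hv]; rewrite /preimage /= ?linear0 ?linearP.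
  exact: submodule0.
by apply: h.2.
Qed.

Lemma submodule_im (S : set M) : submodule S -> submodule (f @` S).
Proof.
move=> h; split; first by exists 0; [apply: submodule0 | rewrite linear0].
move=> a _ _ [x hx <-] [y hy <-]; exists (a *: x + y); first exact: h.2.
by rewrite linearP.
Qed.

Lemma submodule_set0 : submodule [set 0 : M].
Proof. by split=> // a u v -> ->; rewrite scaler0 addr0. Qed.

Lemma submodule_setT : submodule [set: M].
Proof. by split. Qed.

Lemma submodule_ker : submodule [set x | f x = 0].
Proof. by split=> [|a u v /= hu hv];
  rewrite /= ?linear0 // linearP hu hv scaler0 addr0. Qed.

Lemma ker0_inj : (forall x, f x = 0 -> x = 0) -> injective f.
Proof.
move=> h x y e; apply/eqP; rewrite -subr_eq0; apply/eqP; apply: h.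
by rewrite linearB e subrr.
Qed.

Lemma bij_linv : bijective f ->
  exists g : {linear N -> M}, cancel f g /\ cancel g f.
Proof.
move=> [g fK gK].
have lg : linear g.
  by move=> a x y; apply: (can_inj fK); rewrite linearP !gK.
by exists (linear_of lg).
Qed.

Lemma inj_surj_bij : injective f -> (forall y, exists x, f x = y) -> bijective f.
Proof.
move=> fi fs; have [g hg] := choice fs.
by exists g => // x; apply: fi; rewrite hg.
Qed.

End Linear.

Lemma factor_surj (A : pzRingType) (M N Q : lmodType A) (p : {linear M -> N})
    (g : {linear M -> Q}) :
  (forall y, exists x, p x = y) -> (forall x, p x = 0 -> g x = 0) ->
  exists h : {linear N -> Q}, forall x, h (p x) = g x.
Proof.
move=> ps hk.
have [||y [x px <-]|h hh] := @linear_relation A N Q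
  (fun y z => exists2 x, p x = y & g x = z).
- by move=> y; have [x <-] := ps y; exists (g x), x.
- move=> a _ _ _ _ [x <- <-] [y <- <-]; exists (a *: x + y); by rewrite linearP.
- exact: hk.
exists h => x; have [y e <-] := hh (p x).
by apply/eqP; rewrite -subr_eq0 -linearB hk ?linearB ?e ?subrr.
Qed.

Lemma factor_inj (A : pzRingType) (M N Q : lmodType A) (i : {linear M -> N})
    (g : {linear Q -> N}) :
  injective i -> (forall x, exists y, i y = g x) ->
  exists h : {linear Q -> M}, forall x, i (h x) = g x.
Proof.
move=> ii hg; apply: (@linear_relation A Q M (fun x y => i y = g x)) => //.
- by move=> a x y x' y' h h'; rewrite !linearP h h'.
- by move=> y e; apply: ii; rewrite e !linear0.
Qed.

Section SubmoduleType.
Variables (A : pzRingType) (M : lmodType A) (S : set M).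

(** The proof is a phantom argument: it makes [sm_pred hS] a head symbol on which the closure
    properties can be registered. *)
Definition sm_pred of submodule S : {pred M} := fun x => `[< S x >].

Variable hS : submodule S.

Fact sm_pred_closed : submod_closed (sm_pred hS).
Proof.
split; first by apply/asboolP; apply: submodule0.
by move=> a u v /asboolP hu /asboolP hv; apply/asboolP; apply: hS.2.
Qed.

HB.instance Definition _ := GRing.isSubmodClosed.Build A M (sm_pred hS) sm_pred_closed.

Record sm_type := SmType { sm_val :> M; _ : sm_val \in sm_pred hS }.
HB.instance Definition _ := [isSub for sm_val].
HB.instance Definition _ := [Choice of sm_type by <:].
HB.instance Definition _ := [SubChoice_isSubLmodule of sm_type by <:].
End SubmoduleType.

Lemma sub_exists (A : pzRingType) (M : lmodType A) (S : set M) :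
  submodule S -> exists (Q : lmodType A) (i : {linear Q -> M}),
    injective i /\ (forall x, S x <-> exists q, i q = x).
Proof.
move=> hS; exists (sm_type hS : lmodType A), (\val : {linear sm_type hS -> M}).
split; first exact: val_inj.
move=> x; split=> [hx|[q <-]]; last by have := valP q => /asboolP.
by exists (SmType (asboolT hx : x \in sm_pred hS)).
Qed.

Section QuotientType.
Variables (A : pzRingType) (M : lmodType A) (S : set M).

(** The default 0 is never reached, since x itself lies in its coset. Cosets are represented by the
    fixed points of this function, so the quotient is a subtype of M and inherits its choice
    structure. *)
Definition coset_rep of submodule S : M -> M :=
  fun x => xget 0 [set y | S (y - x)].

Variable hS : submodule S.
Local Notation rep := (coset_rep hS).

Fact coset_repP x : S (rep x - x).
Proof.
by apply: (@xgetPex _ 0 [set y | S (y - x)]); exists x; rewrite /= subrr;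
  apply: submodule0.
Qed.

Fact coset_rep_eq x y : S (x - y) -> rep x = rep y.
Proof.
move=> h; rewrite /coset_rep; congr xget; apply/seteqP; split=> z /= hz.
  by rewrite -(subrKA x); apply: submoduleD.
by rewrite -(subrKA y) -(opprB x y); apply: submoduleB.
Qed.

Definition quo := {x : M | rep x == x}.
HB.instance Definition _ := SubChoice.on quo.

Fact rep_idem x : rep (rep x) == rep x.
Proof. by apply/eqP/coset_rep_eq/coset_repP. Qed.

Definition qcl x : quo := exist _ (rep x) (rep_idem x).

Fact qcl_eq x y : S (x - y) -> qcl x = qcl y.
Proof. by move=> h; apply: val_inj; apply: coset_rep_eq. Qed.

Fact qcl_eqP x y : qcl x = qcl y -> S (x - y).
Proof.
move=> /(congr1 val) /= e; rewrite -(subrKA (rep x)).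
apply: submoduleD => //; last by rewrite e; apply: coset_repP.
by rewrite -opprB; apply: submoduleN (coset_repP x).
Qed.

Fact qclK u : qcl (val u) = u.
Proof. by apply: val_inj; apply/eqP; case: u. Qed.

Fact val_qcl x : S (val (qcl x) - x).
Proof. exact: coset_repP. Qed.

Definition qadd (u v : quo) := qcl (val u + val v).
Definition qopp (u : quo) := qcl (- val u).
Definition qscale (a : A) (u : quo) := qcl (a *: val u).

Fact qaddE x y : qadd (qcl x) (qcl y) = qcl (x + y).
Proof.
by apply: qcl_eq; rewrite opprD addrACA; apply: submoduleD => //; apply: val_qcl.
Qed.
Fact qoppE x : qopp (qcl x) = qcl (- x).
Proof. by apply: qcl_eq; rewrite -opprD; apply: submoduleN => //; apply: val_qcl. Qed.
Fact qscaleE a x : qscale a (qcl x) = qcl (a *: x).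
Proof. by apply: qcl_eq; rewrite -scalerBr; apply: submoduleZ => //;
  apply: val_qcl. Qed.

Fact qaddA : associative qadd.
Proof. by move=> x y z; rewrite -(qclK x) -(qclK y) -(qclK z) !qaddE addrA. Qed.
Fact qaddC : commutative qadd.
Proof. by move=> x y; rewrite -(qclK x) -(qclK y) !qaddE addrC. Qed.
Fact qadd0 : left_id (qcl 0) qadd.
Proof. by move=> x; rewrite -(qclK x) !qaddE add0r. Qed.
Fact qaddN : left_inverse (qcl 0) qopp qadd.
Proof. by move=> x; rewrite -(qclK x) qoppE !qaddE addNr. Qed.

HB.instance Definition _ := GRing.isZmodule.Build quo qaddA qaddC qadd0 qaddN.

Fact qscaleA a b v : qscale a (qscale b v) = qscale (a * b) v.
Proof. by rewrite -(qclK v) !qscaleE scalerA. Qed.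
Fact qscale1 : left_id 1 qscale.
Proof. by move=> v; rewrite -(qclK v) !qscaleE scale1r. Qed.
Fact qscaleDr : right_distributive qscale +%R.
Proof.
move=> a x y; rewrite -(qclK x) -(qclK y); rewrite [LHS](congr1 (qscale a) (qaddE _ _)).
by rewrite !qscaleE scalerDr -qaddE.
Qed.
Fact qscaleDl v : {morph qscale^~ v : a b / a + b}.
Proof. by move=> a b; rewrite -(qclK v) !qscaleE scalerDl -qaddE. Qed.

HB.instance Definition _ :=
  GRing.Zmodule_isLmodule.Build A quo qscaleA qscale1 qscaleDr qscaleDl.

Fact qcl_linear : linear qcl.
Proof. by move=> a x y; rewrite -qaddE -qscaleE. Qed.
End QuotientType.

Lemma quot_exists (A : pzRingType) (M : lmodType A) (S : set M) :
  submodule S -> exists (Q : lmodType A) (p : {linear M -> Q}),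
    (forall y, exists x, p x = y) /\ (forall x, S x <-> p x = 0).
Proof.
move=> hS; exists (quo hS : lmodType A), (linear_of (@qcl_linear _ _ _ hS)).
split=> [y|x]; first by exists (val y); apply: qclK.
rewrite linear_ofE; split=> [h|].
  by apply: qcl_eq; rewrite subr0.
by move=> /(@qcl_eqP A M S hS x 0); rewrite subr0.
Qed.

(** * Finite length *)

(** In M/H the class of z is nonzero and lies in every nonzero submodule. Such an H separates z from
    B as a functional into an injective hull would. *)
Lemma maximal_avoiding (A : pzRingType) (M : lmodType A) (B : set M) (z : M) :
  submodule B -> ~ B z ->
  exists H : set M, [/\ submodule H, B `<=` H, ~ H z
    & forall v, ~ H v -> exists (r : A) (h : M), H h /\ z = r *: v + h].
Proof.
move=> hB nBz.
pose Q := [set S : set M | S = set0 \/ [/\ submodule S, B `<=` S & ~ S z]].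
have [F FQ totF|H [QH maxH]] := @Zorn_bigcup M Q.
  have [F0|[X0 [FX0 nX0]]] :
      (forall X, F X -> X = set0) \/ exists X, F X /\ X <> set0.
    have [/existsPNP [X FX nX]|h] := pselect (~ forall X, F X -> X = set0).
      by right; exists X.
    by left; apply: contrapT.
    left; apply/seteqP; split=> // x [X FX]; by rewrite (F0 X FX).
  have good X : F X -> X <> set0 -> [/\ submodule X, B `<=` X & ~ X z].
    by move=> FX; have [] := FQ X FX.
  have [smX0 BX0 _] := good _ FX0 nX0.
  right; split.
  - split; first by exists X0 => //; apply: submodule0.
    move=> a u v [X FX Xu] [Y FY Yv].
    have [smX _ _] := good X FX ltac:(by move=> e; rewrite e in Xu).
    have [smY _ _] := good Y FY ltac:(by move=> e; rewrite e in Yv).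
    have [XY|YX] := totF X Y FX FY.
      by exists Y => //; apply: smY.2 => //; apply: XY.
    by exists X => //; apply: smX.2 => //; apply: YX.
  - by move=> b /BX0 h; exists X0.
  - move=> [X FX Xz]; have [_ _ nXz] := good X FX ltac:(by move=> e; rewrite e in Xz).
    exact: nXz.
case: QH => [H0|[smH BH nHz]].
  exfalso; apply: (maxH B); last by right; split.
  by rewrite H0; split=> // /(_ 0); apply; apply: submodule0.
exists H; split=> // v nHv; apply: contrapT => nex.
pose T := [set x | exists (r : A) (h : M), H h /\ x = r *: v + h].
apply: (maxH T).
  split; last first.
    by move=> h; apply: nHv; apply: h; exists 1, 0; split;
      [apply: submodule0|rewrite scale1r addr0].
  by move=> x hx; exists 0, x; rewrite scale0r add0r.
right; split.
- split; first by exists 0, 0; split; [apply: submodule0|rewrite scale0r addr0].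
  move=> a _ _ [r [h [hh ->]]] [r' [h' [hh' ->]]].
  exists (a * r + r'), (a *: h + h'); split; first exact: smH.2.
  by rewrite scalerDr scalerA scalerDl addrACA.
- by move=> x /BH hx; exists 0, x; rewrite scale0r add0r.
- exact: nex.
Qed.

(** The quotient T/S is zero or simple: every nonzero class generates it. Zero factors are allowed
    so that preimages of a series are again a series; its length is then only an upper bound. *)
Definition step (A : pzRingType) (M : lmodType A) (S T : set M) : Prop :=
  [/\ submodule S, submodule T, S `<=` T
    & forall x y, T x -> T y -> ~ S x -> ~ S y -> exists r : A, S (x - r *: y)].

Inductive series (A : pzRingType) (M : lmodType A) (K : set M) :
    set M -> nat -> Prop :=
| series0 : series K K 0
| seriesS S T n : series K S n -> step S T -> series K T n.+1.

Section Series.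
Variable A : pzRingType.

Lemma series_trans (M : lmodType A) (K S T : set M) m n :
  series K S m -> series S T n -> series K T (m + n).
Proof.
move=> h; elim=> [|U V k _ IH st]; first by rewrite addn0.
by rewrite addnS; apply: seriesS IH st.
Qed.

Lemma series1 (M : lmodType A) (S T : set M) : step S T -> series S T 1.
Proof. by move=> h; apply: seriesS h; apply: series0. Qed.

Lemma series_preim (M N : lmodType A) (f : {linear M -> N}) (D : set M)
    (K S : set N) n :
  submodule D -> series K S n ->
  series (f @^-1` K `&` D) (f @^-1` S `&` D) n.
Proof.
move=> hD; elim=> [|U V k _ IH [hU hV UV st]]; first exact: series0.
apply: seriesS IH _; split.
- split; first by split; [apply: (submodule_preim f hU).1|apply: hD.1].
  by move=> a u v [u1 u2] [v1 v2]; split; [apply: (submodule_preim f hU).2|apply: hD.2].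
- split; first by split; [apply: (submodule_preim f hV).1|apply: hD.1].
  by move=> a u v [u1 u2] [v1 v2]; split; [apply: (submodule_preim f hV).2|apply: hD.2].
- by move=> x [hx Dx]; split=> //; apply: UV.
- move=> x y [Vx Dx] [Vy Dy] nx ny.
  have [||r hr] := st _ _ Vx Vy; [by move=> h; apply: nx|by move=> h; apply: ny|].
  exists r; split; last by apply: submoduleB => //; apply: submoduleZ.
  by rewrite /preimage /= linearB linearZ.
Qed.

(* The rank counts the factors of the series that meet S nontrivially; by the
   modular law it is strictly increasing in S. *)
Lemma series_rank (M : lmodType A) (K T : set M) n : series K T n ->
  exists rk : set M -> nat,
    [/\ forall S, (rk S <= n)%N,
        forall S S', S `<=` S' -> (rk S <= rk S')%N
      & forall S S', submodule S -> submodule S' -> S `<=` S' ->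
          rk S = rk S' -> S' `&` K `<=` S -> S' `&` T `<=` S].
Proof.
elim=> [|U V k _ [rk [h1 h2 h3]] [hU hV UV st]]; first by exists (fun=> 0%N).
pose b S : bool := `[< exists x, [/\ S x, V x & ~ U x] >].
have bm S S' : S `<=` S' -> (b S <= b S')%N.
  move=> SS'; case E: (b S) => //.
  have -> : b S'; last by [].
  by move/asboolP: E => [x [? ? ?]]; apply/asboolP; exists x; split=> //; apply: SS'.
exists (fun S => rk S + b S)%N; split.
- by move=> S; rewrite -addn1 leq_add // leq_b1.
- by move=> S S' SS'; apply: leq_add; [apply: h2 | apply: bm].
- move=> S S' hS hS' SS' e K1.
  have l1 := h2 _ _ SS'; have l2 := bm _ _ SS'.
  have e1 : rk S = rk S'.
    apply/eqP; rewrite eqn_leq l1 /= -(leq_add2r (b S)) e.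
    by rewrite leq_add2l.
  have e2 : b S = b S'.
    by move: e; rewrite e1 => /addnI; case: (b S); case: (b S').
  have U1 := h3 _ _ hS hS' SS' e1 K1.
  move=> x [S'x Vx]; have [Ux|nUx] := pselect (U x); first exact: U1.
  have : b S' by apply/asboolP; exists x.
  rewrite -e2 => /asboolP [y [Sy Vy nUy]].
  have [r hr] := st x y Vx Vy nUx nUy.
  rewrite -(subrK (r *: y) x); apply: submoduleD => //; last exact: submoduleZ.
  by apply: U1; split=> //; apply: submoduleB => //; apply: submoduleZ => //;
    apply: SS'.
Qed.
End Series.

(** An upper bound n for the length of M, witnessed by a strictly monotone number on submodules. *)
Definition ranked (A : pzRingType) (M : lmodType A) (n : nat) : Prop :=
  exists rk : set M -> nat, (forall S, (rk S <= n)%N) /\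
    forall S S', submodule S -> submodule S' -> S `<=` S' -> ~ S' `<=` S ->
      (rk S < rk S')%N.

Lemma series_ranked (A : pzRingType) (M : lmodType A) n :
  series [set 0 : M] setT n -> ranked M n.
Proof.
move=> /series_rank [rk [h1 h2 h3]]; exists rk; split=> // S S' hS hS' SS' n1.
rewrite ltn_neqAle h2 // andbT; apply/eqP => e; apply: n1 => x S'x.
by apply: (h3 _ _ hS hS' SS' e) => // y [_ ->]; apply: submodule0.
Qed.

(** * From Artinian base rings to modules of finite length *)

Lemma artinian_min (R : comPzRingType) (Q : set (set R^o)) (J0 : set R^o) :
  artinian R -> (forall J, Q J -> submodule J) -> Q J0 ->
  exists J, Q J /\ forall J', Q J' -> J' `<=` J -> J' = J.
Proof.
move=> art sm Q0; apply: contrapT => nex.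
have next J : exists J', Q J -> [/\ Q J', J' `<=` J & J' <> J].
  have [QJ|nQ] := pselect (Q J); last by exists J.
  apply: contrapT => h; apply: nex; exists J; split=> // J' QJ' JJ'.
  by apply: contrapT => ne; apply: h; exists J'.
have [g hg] := choice next.
have Qn n : Q (iter n g J0) by elim: n => //= n /hg [].
have [n hn] := art (fun n => iter n g J0) (fun n => sm _ (Qn n))
  (fun n => ltac:(by have [] := hg _ (Qn n))).
by have [_ _] := hg _ (Qn n); apply; apply: (hn n.+1).
Qed.

Lemma mulr_linear (R : comPzRingType) (r : R) : linear (fun x : R^o => r *: x).
Proof. by move=> a x y; rewrite scalerDr !scalerA mulrC. Qed.

(* A minimal ideal I without a finite series would be annihilated by a maximal
   ideal, while a subspace of I complementing a line has a finite series. *)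
Lemma artinian_series (R : comPzRingType) : artinian R ->
  exists n, series [set 0 : R^o] setT n.
Proof.
move=> art; apply: contrapT => nser.
have [||I [[smI nI] minI]] := @artinian_min R
  [set J | submodule J /\ ~ exists n, series [set 0] J n] setT art.
- by move=> J [].
- by split; [apply: submodule_setT|].
have proper J : submodule J -> J `<=` I -> ~ I `<=` J -> exists n, series [set 0] J n.
  move=> hJ JI nIJ; apply: contrapT => h; apply: nIJ.
  by rewrite -(minI J).
(* If the kernel of r on I and the image r I were both proper in I, each would have a finite series
   by minimality, and the two would combine into a series of I. *)
have dich r : (forall x, I x -> r *: x = 0) \/ (forall x, I x -> exists2 y, I y
  & r *: y = x).
  have [h|n1] := pselect (forall x, I x -> r *: x = 0); [by left|right].
  apply: contrapT => n2; apply: nI.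
  pose f := linear_of (@mulr_linear R r).
  have [|||m hm] := proper (f @` I).
  - exact: submodule_im.
  - by move=> _ [x Ix <-]; apply: submoduleZ.
  - by move=> h; apply: n2 => x /h [y]; exists y.
  have [|||k hk] := proper (f @^-1` [set 0] `&` I).
  - by have := series_preim f smI (series0 [set 0]); split;
      [split; [apply: (submodule_ker f).1|apply: smI.1]
      |move=> a u v [u1 u2] [v1 v2]; split; [apply: (submodule_ker f).2|apply: smI.2]].
  - by move=> x [].
  - by move=> h; apply: n1 => x /h [].
  exists (k + m)%N; apply: series_trans hk _.
  have e : f @^-1` (f @` I) `&` I = I.
    by apply/seteqP; split=> [x []|x Ix] //; split=> //; exists x.
  by have := series_preim f smI hm; rewrite e.
(* Here r maps I onto itself. The chain of ideals r^n R stabilises, so r^n = r^(n+1) s for some n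
   and s; applying this to y with x = r^n y gives s r x = x. *)
have inv r : ~ (forall x, I x -> r *: x = 0) ->
    exists s, forall x, I x -> s *: (r *: x) = x.
  move=> nr; have [//|sur] := dich r.
  pose J n := [set x : R^o | exists s, x = r ^+ n * s].
  have [||n hn] := art J.
  - move=> n; split; first by exists 0; rewrite mulr0.
    move=> a _ _ [s ->] [t ->]; exists (a * s + t).
    by rewrite mulrDr mulrCA.
  - by move=> n _ [s ->]; exists (r * s); rewrite mulrA -exprSr.
  have : J n (r ^+ n) by exists 1; rewrite mulr1.
  rewrite -(hn n.+1) // => -[s e].
  have surn k x : I x -> exists2 y, I y & r ^+ k *: y = x.
    elim: k x => [|k IH] x Ix; first by exists x; rewrite ?scale1r.
    have [y Iy <-] := IH x Ix; have [z Iz <-] := sur y Iy.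
    by exists z => //; rewrite scalerA -exprSr.
  exists s => x Ix; have [y Iy <-] := surn n x Ix.
  by rewrite !scalerA -mulrA -exprS mulrC -e.
have [x [Ix nx]] : exists x, I x /\ x <> 0.
  apply: contrapT => h; apply: nI; exists 0%N.
  have -> : I = [set 0]; last exact: series0.
  apply/seteqP; split=> [x Ix|x ->]; last exact: submodule0.
  by apply: contrapT => nx; apply: h; exists x.
have [H [smH _ nHx Hmax]] := maximal_avoiding (submodule_set0 R^o) nx.
have smHI : submodule (H `&` I).
  split; first by split; apply: submodule0.
  by move=> a u v [? ?] [? ?]; split; [apply: smH.2|apply: smI.2].
have [n hn] : exists n, series [set 0] (H `&` I) n.
  by apply: proper => // h; have [] := h x Ix.
apply: nI; exists n.+1; apply: seriesS hn _; split=> //.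
have line u : I u -> ~ (H `&` I) u -> exists r s h,
    [/\ x = r *: u + h, (H `&` I) h & forall x, I x -> s *: (r *: x) = x].
  move=> Iu nu; have [|r [h [Hh e]]] := Hmax u; first by move=> Hu; apply: nu.
  have Ih : I h.
    have -> : h = x - r *: u by rewrite e addrC addKr.
    by apply: submoduleB => //; apply: submoduleZ.
  have [|s hs] := inv r; last by exists r, s, h.
  by move=> h0; apply: nHx; rewrite e h0 // add0r.
move=> u v Iu Iv nu nv.
have [r [s [h [e hh hs]]]] := line u Iu nu.
have [r' [s' [h' [e' hh' hs']]]] := line v Iv nv.
(* Both u and v express x modulo H [&] I, and s inverts r on I, so u - s r' v = s (r u - r' v) = s
   (h' - h). *)
exists (s * r').
have -> : u - (s * r') *: v = s *: (r *: u - r' *: v).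
  by rewrite scalerBr hs // scalerA.
apply: submoduleZ => //.
have -> : r *: u - r' *: v = h' - h; last exact: submoduleB.
by apply/eqP; rewrite subr_eq addrAC eq_sym subr_eq addrC -e' -e.
Qed.

Fixpoint lspan (A : pzRingType) (M : lmodType A) (s : seq M) : set M :=
  if s is g :: s' then
    [set x | exists (r : A) (y : M), lspan s' y /\ x = r *: g + y]
  else [set 0].

Lemma submodule_lspan (A : pzRingType) (M : lmodType A) (s : seq M) : submodule
  (lspan s).
Proof.
elim: s => [|g s IH]; first exact: submodule_set0.
split; first by exists 0, 0; split; [apply: submodule0|rewrite scale0r addr0].
move=> a _ _ [r [h [hh ->]]] [r' [h' [hh' ->]]].
exists (a * r + r'), (a *: h + h'); split; first exact: IH.2.
by rewrite scalerDr scalerA scalerDl addrACA.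
Qed.

Lemma lspan_mem (A : pzRingType) (M : lmodType A) (s : seq M) x :
  x \in s -> lspan s x.
Proof.
elim: s => //= g s IH; rewrite inE => /orP [/eqP ->|/IH h].
  by exists 1, 0; split; [exact: submodule0 (submodule_lspan _)|rewrite scale1r addr0].
by exists 0, x; rewrite scale0r add0r.
Qed.

Lemma lspan_min (A : pzRingType) (M : lmodType A) (s : seq M) S :
  submodule S -> (forall x, x \in s -> S x) -> lspan s `<=` S.
Proof.
move=> hS; elim: s => [|g s IH] h; first by move=> x ->; apply: submodule0.
move=> _ [r [y [hy ->]]]; apply: hS.2; first by apply: h; rewrite mem_head.
by apply: IH => // x hx; apply: h; rewrite inE hx orbT.
Qed.

Lemma fin_gen_lspan (A : pzRingType) (M : lmodType A) :
  fin_gen M <-> exists s : seq M, lspan s = setT.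
Proof.
split=> [[n [g hg]]|[s hs]].
  exists (codom g); apply/seteqP; split=> // x _; have [c ->] := hg x.
  apply: submodule_sum => [|i _]; first exact: submodule_lspan.
  by apply: submoduleZ; [apply: submodule_lspan|apply: lspan_mem; apply: codom_f].
exists (size s), (fun i => s`_i) => x.
have : lspan s x by rewrite hs.
elim: s x {hs} => [|g s IH] x /=.
  by move=> ->; exists (fun=> 0); rewrite big_ord0.
move=> [r [y [/IH [c ->] ->]]].
exists (fun i => if unlift ord0 i is Some j then c j else r).
rewrite big_ord_recl unlift_none /=; congr (_ + _).
by apply: eq_bigr => i _; rewrite liftK.
Qed.

Lemma fin_gen_series (R : comPzRingType) (M : lmodType R) n :
  series [set 0 : R^o] setT n -> fin_gen M ->
  exists m, series [set 0 : M] setT m.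
Proof.
move=> hR /fin_gen_lspan [s <-]; elim: s => [|g s [m IH]] /=.
  by exists 0%N; apply: series0.
exists (m + n)%N; apply: series_trans IH _.
(* Adding the generator g enlarges the span by a quotient of R: the series of R is transported by
   sending an ideal G to G g plus the old span. *)
pose T (G : set R^o) := [set x |
  exists (r : R) y, [/\ G r, lspan s y & x = r *: g + y]].
have smT G : submodule G -> submodule (T G).
  move=> hG; split.
    by exists 0, 0; split;
      [exact: hG.1|exact: submodule0 (submodule_lspan _)|rewrite scale0r addr0].
  move=> a _ _ [r [h [Gr hh ->]]] [r' [h' [Gr' hh' ->]]].
  exists (a * r + r'), (a *: h + h'); split;
    [exact: hG.2|exact: (submodule_lspan s).2|].
  by rewrite scalerDr scalerA scalerDl addrACA.
have : series (T [set 0]) (T setT) n.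
  elim: hR => [|G G' k _ IH [hG hG' GG' st]]; first exact: series0.
  apply: seriesS IH _; split; [exact: smT|exact: smT| |].
    by move=> _ [r [y [? ? ->]]]; exists r, y; split=> //; apply: GG'.
  move=> _ _ [r [y [Gr hy ->]]] [r' [y' [Gr' hy' ->]]] n1 n2.
  have [||c hc] := st r r' Gr Gr'.
  - by move=> h; apply: n1; exists r, y.
  - by move=> h; apply: n2; exists r', y'.
  exists c, (r - c * r'), (y - c *: y'); split=> //.
    by apply: submoduleB => //;
      [apply: submodule_lspan|apply: submoduleZ => //; apply: submodule_lspan].
  by rewrite scalerDr scalerA scalerBl opprD addrACA.
congr (series _ _ _); apply/seteqP; split=> x.
- by move=> [r [y [-> hy ->]]]; rewrite scale0r add0r.
- by move=> hx; exists 0, x; rewrite scale0r add0r.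
- by move=> [r [y [_ hy ->]]]; exists r, y.
- by move=> [r [y [hy ->]]]; exists r, y.
Qed.

Section RestrictionOfScalars.
Variables (R : comPzRingType) (A : algType R) (M : lmodType A).

(** An alias of M with the same elements and addition, so a set of elements of M can be read
    unchanged as a set of elements of the R-module, and a rank over R serves for A-submodules
    too. *)
Definition restr : Type := M.
HB.instance Definition _ := GRing.Zmodule.copy restr M.

Definition restr_scale (r : R) (x : restr) : restr := (r%:A : A) *: (x : M).

Fact restr_scaleA a b v :
  restr_scale a (restr_scale b v) = restr_scale (a * b) v.
Proof. by rewrite /restr_scale scalerA -scalerAl mul1r scalerA. Qed.
Fact restr_scale1 : left_id 1 restr_scale.
Proof. by move=> v; rewrite /restr_scale scale1r scale1r. Qed.
Fact restr_scaleDr : right_distributive restr_scale +%R.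
Proof. by move=> a x y; rewrite /restr_scale scalerDr. Qed.
Fact restr_scaleDl v : {morph restr_scale^~ v : a b / a + b}.
Proof. by move=> a b; rewrite /restr_scale !scalerDl. Qed.

HB.instance Definition _ :=
  GRing.Zmodule_isLmodule.Build R restr
    restr_scaleA restr_scale1 restr_scaleDr restr_scaleDl.
End RestrictionOfScalars.

Lemma submodule_restr (R : comPzRingType) (A : algType R) (M : lmodType A) (S : set M) :
  submodule S -> submodule (S : set (restr M)).
Proof. by move=> [h0 h]; split=> // a u v; apply: h. Qed.

Lemma restr_fin_gen (R : comPzRingType) (A : algType R) (M : lmodType A) :
  fin_gen (A : lmodType R) -> fin_gen M -> fin_gen (restr M : lmodType R).
Proof.
move=> /fin_gen_lspan [s hs] /fin_gen_lspan [t ht]; apply/fin_gen_lspan.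
exists [seq ((a : A) *: (g : M) : M) | a <- s, g <- t].
set S := lspan _; have smS : submodule S by apply: submodule_lspan.
have h g : g \in t -> forall a : A, S (a *: g).
  move=> gt a; have : @lspan R A s a by rewrite hs.
  apply: (@lspan_min R A s [set b : A | S (b *: g)]).
    split=> [|r u v hu hv]; first by rewrite /= scale0r; apply: (submodule0 smS).
    have := smS.2 r _ _ hu hv.
    by rewrite /= scalerDl /GRing.scale /= /restr_scale scalerA mulr_algl.
  by move=> b bs; apply: lspan_mem; apply: allpairs_f.
apply/seteqP; split=> // x _.
have : lspan t x by rewrite ht.
suff sub : lspan t `<=` [set y : M | forall a : A, S (a *: y)].
  by move=> /sub /(_ 1); rewrite scale1r.
apply: lspan_min => [|g gt a]; last exact: h.
split=> [a|b u v hu hv a]; first by rewrite scaler0; apply: (submodule0 smS).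
rewrite scalerDr scalerA; exact: (submoduleD smS).
Qed.

Lemma artin_ranked (R : comPzRingType) (A : algType R) (M : lmodType A) :
  artin_algebra A -> fin_gen M -> exists n, ranked M n.
Proof.
move=> [/artinian_series [k hk] fA] fM.
have [n /series_ranked [rk [h1 h2]]] := fin_gen_series hk (restr_fin_gen fA fM).
exists n, rk; split=> // S S' hS hS'; apply: h2; exact: submodule_restr.
Qed.

Section Ranked.
Variables (A : pzRingType) (M : lmodType A) (n : nat).
Hypothesis rM : ranked M n.

Lemma ranked_max (Q : set (set M)) S0 :
  (forall S, Q S -> submodule S) -> Q S0 ->
  exists S, Q S /\ forall S', Q S' -> S `<=` S' -> S' `<=` S.
Proof.
move=> sm Q0; have [rk [h1 h2]] := rM.
have ex : exists k, `[< exists S, Q S /\ rk S = k >].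
  by exists (rk S0); apply/asboolP; exists S0.
have ub k : `[< exists S, Q S /\ rk S = k >] -> (k <= n)%N.
  by move=> /asboolP [S [_ <-]].
case: (ex_maxnP ex ub) => k /asboolP [S [QS <-]] hk.
exists S; split=> // S' QS' SS'; apply: contrapT => nS'S.
have := h2 _ _ (sm _ QS) (sm _ QS') SS' nS'S.
by rewrite ltnNge hk //; apply/asboolP; exists S'.
Qed.

Lemma ranked_min (Q : set (set M)) S0 :
  (forall S, Q S -> submodule S) -> Q S0 ->
  exists S, Q S /\ forall S', Q S' -> S' `<=` S -> S `<=` S'.
Proof.
move=> sm Q0; have [rk [h1 h2]] := rM.
have ex : exists k, `[< exists S, Q S /\ rk S = k >].
  by exists (rk S0); apply/asboolP; exists S0.
case: (ex_minnP ex) => k /asboolP [S [QS <-]] hk.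
exists S; split=> // S' QS' SS'; apply: contrapT => nS'S.
have := h2 _ _ (sm _ QS') (sm _ QS) SS' nS'S.
by rewrite ltnNge hk //; apply/asboolP; exists S'.
Qed.

Lemma sub_lspan (S : set M) : submodule S -> exists s, lspan s = S.
Proof.
move=> hS; have [||_ [[s <- sS] hmax]] :=
  @ranked_max [set T | exists2 s, lspan s = T & lspan s `<=` S] [set 0].
- by move=> _ [s <- _]; apply: submodule_lspan.
- by exists [::] => // x ->; apply: submodule0.
exists s; apply/seteqP; split=> // x Sx.
apply: (hmax (lspan (x :: s))).
- exists (x :: s) => //; apply: lspan_min => // y.
  rewrite inE => /orP [/eqP ->|] // ys; apply: sS; exact: lspan_mem.
- apply: lspan_min; first exact: submodule_lspan.
  by move=> y ys; apply: lspan_mem; rewrite inE ys orbT.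
- by apply: lspan_mem; rewrite mem_head.
Qed.

Lemma ranked_chain (k : nat) (S : nat -> set M) :
  (forall i, submodule (S i)) ->
  (forall i, (i < k)%N -> S i `<=` S i.+1 /\ ~ S i.+1 `<=` S i) ->
  (k <= n)%N.
Proof.
move=> hS hk; have [rk [h1 h2]] := rM.
suff : forall i, (i <= k)%N -> (i <= rk (S i))%N.
  by move=> /(_ k (leqnn _)) /leq_trans; apply.
elim=> // i IH ik; have [s1 s2] := hk i ik.
exact: leq_ltn_trans (IH (ltnW ik)) (h2 _ _ (hS _) (hS _) s1 s2).
Qed.
End Ranked.

Lemma fin_gen_surj (A : pzRingType) (M N : lmodType A) (f : {linear M -> N}) :
  (forall y, exists x, f x = y) -> fin_gen M -> fin_gen N.
Proof.
move=> fs [n [g hg]]; exists n, (f \o g) => y.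
have [x <-] := fs y; have [c ->] := hg x; exists c.
by rewrite linear_sum; apply: eq_bigr => i _; rewrite linearZ.
Qed.

Lemma fin_gen_inj (A : pzRingType) (M N : lmodType A) (f : {linear M -> N}) n :
  ranked N n -> injective f -> fin_gen M.
Proof.
move=> rN fi; have [s hs] := sub_lspan rN (submodule_im f (submodule_setT M)).
have [t ht] : exists t : seq M, map f t = s.
  have : forall y, y \in s -> exists x, f x = y.
    move=> y /lspan_mem; rewrite hs => -[x _ <-]; by exists x.
  elim: s {hs} => [|y s IH] h; first by exists [::].
  have [x hx] := h y (mem_head _ _).
  have [|t ht] := IH; first by move=> z zs; apply: h; rewrite inE zs orbT.
  by exists (x :: t) => /=; rewrite hx ht.
apply/fin_gen_lspan; exists t; apply/seteqP; split=> // x _.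
have [y hy /fi <-] : (f @` lspan t) (f x); last by [].
have : lspan s (f x) by rewrite hs; exists x.
apply: lspan_min; first exact/submodule_im/submodule_lspan.
move=> y; rewrite -ht => /mapP [z zt ->]; exists z => //; exact: lspan_mem.
Qed.

Lemma fin_gen_prod (A : pzRingType) (M N : lmodType A) :
  fin_gen M -> fin_gen N -> fin_gen ((M * N)%type : lmodType A).
Proof.
move=> /fin_gen_lspan [s hs] /fin_gen_lspan [t ht]; apply/fin_gen_lspan.
exists ([seq (x, 0) | x <- s] ++ [seq (0, y) | y <- t]).
set S := lspan _; have hS : submodule S by apply: submodule_lspan.
apply/seteqP; split=> // -[x y] _.
have -> : (x, y) = (x, 0) + (0, y) by congr pair; rewrite /= ?addr0 ?add0r.
apply: submoduleD => //.
- have : lspan s x by rewrite hs.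
  apply: (@lspan_min _ _ s [set x | S (x, 0)]).
    split=> [|a u v hu hv]; first exact: (submodule0 hS).
    have -> : [set x | S (x, 0)] (a *: u + v) = S (a *: (u, 0) + (v, 0)).
      by congr (S (_, _)); rewrite /= scaler0 addr0.
    exact: hS.2.
  by move=> z zs; apply: lspan_mem; rewrite mem_cat map_f.
- have : lspan t y by rewrite ht.
  apply: (@lspan_min _ _ t [set y | S (0, y)]).
    split=> [|a u v hu hv]; first exact: (submodule0 hS).
    have -> : [set y | S (0, y)] (a *: u + v) = S (a *: (0, u) + (0, v)).
      by congr (S (_, _)); rewrite /= scaler0 addr0.
    exact: hS.2.
  by move=> z zs; apply: lspan_mem; rewrite mem_cat map_f ?orbT.
Qed.

Lemma restr_scaleE (R : comPzRingType) (A : algType R) (M : lmodType A) (r : R)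
  (x : restr M) : r *: x = (r%:A : A) *: (x : M).
Proof. by []. Qed.

(** * Indecomposable modules *)

Lemma sum_linear (A : pzRingType) (M N : lmodType A) (J : Type) (r : seq J)
    (Q : pred J) (e : J -> {linear M -> N}) :
  linear (fun x => \sum_(i <- r | Q i) e i x).
Proof.
move=> a x y; rewrite scaler_sumr -big_split; apply: eq_bigr => i _.
exact: linearP.
Qed.

Lemma iter_linear (A : pzRingType) (M : lmodType A) (e : {linear M -> M}) n :
  linear (iter n e).
Proof.
elim: n => [|n IH] a x y //; rewrite [LHS]iterS.
by have /= -> := IH a x y; rewrite linearP.
Qed.

Lemma comp_bij_inj (X Y Z : Type) (f : X -> Y) (g : Y -> Z) :
  bijective (g \o f) -> injective f.
Proof. by move=> [h hK _]; apply: (can_inj (g := h \o g)). Qed.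

Lemma comp_bij_surj (X Y Z : Type) (f : X -> Y) (g : Y -> Z) :
  bijective (g \o f) -> forall z, exists y, g y = z.
Proof. by move=> [h _ Kh] z; exists (f (h z)); apply: Kh. Qed.

Section Indecomposable.
Variables (A : pzRingType) (M : lmodType A).
Hypothesis indM : indecomposable M.

Lemma indec_complement (S T : set M) :
  submodule S -> submodule T -> (forall x, S x -> T x -> x = 0) ->
  (forall x, exists s t, [/\ S s, T t & x = s + t]) ->
  (forall x, S x -> x = 0) \/ (forall x, T x -> x = 0).
Proof.
move=> hS hT ST0 STx.
have [X [i [ii hi]]] := sub_exists hS; have [Y [j [ij hj]]] := sub_exists hT.
pose f (p : X * Y) := i p.1 + j p.2.
have lf : linear (f : (X * Y)%type -> M).
  by move=> a [x y] [x' y']; rewrite /f /= !linearP scalerDr addrACA.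
have bf : bijective (linear_of lf).
  apply: inj_surj_bij => [|m].
    apply: ker0_inj => -[x y]; rewrite linear_ofE /f /= => e.
    have e1 : i x = - j y by apply/eqP; rewrite -addr_eq0 e.
    have e2 : i x = 0.
      apply: ST0; first by apply/hi; exists x.
      by rewrite e1; apply: submoduleN => //; apply/hj; exists y.
    have e3 : j y = 0 by rewrite -e e2 add0r.
    by congr pair; [apply: ii; rewrite e2 linear0|apply: ij; rewrite e3 linear0].
  have [s [t [/hi [x <-] /hj [y <-] ->]]] := STx m.
  by exists (x, y).
have [g [fK gK]] := bij_linv bf.
have [zX|zY] := indM.2 X Y (ex_intro _ g (Bijective gK fK)).
- by left=> _ /hi [x <-]; rewrite (zX x) linear0.
- by right=> _ /hj [x <-]; rewrite (zY x) linear0.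
Qed.

Lemma split_epi_bij (N : lmodType A) (g : {linear M -> N}) :
  ~ zero_mod N -> split_epi g -> bijective g.
Proof.
move=> nN [s sK].
have [||||k0|k0] := @indec_complement [set x | g x = 0] (s @` setT).
- exact: submodule_ker.
- exact/submodule_im/submodule_setT.
- by move=> x /= + [y _ e]; rewrite -e sK => ->; rewrite linear0.
- move=> x; exists (x - s (g x)), (s (g x)); rewrite subrK; split=> //.
    by rewrite /= linearB sK subrr.
- apply: inj_surj_bij; first exact: ker0_inj.
  by move=> y; exists (s y).
- exfalso; apply: nN => y; rewrite -(sK y) (k0 (s y)) ?linear0 //.
Qed.

Lemma split_mono_bij (X : lmodType A) (f : {linear X -> M}) :
  ~ zero_mod X -> split_mono f -> bijective f.
Proof.
move=> nX [r rK]; have /split_epi_bij : split_epi r by exists f.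
by move=> /(_ nX) [h hK Kh]; exists r => // x; rewrite -[RHS]hK -[LHS]hK rK.
Qed.

Variables (n : nat).
Hypothesis rM : ranked M n.

(** Fitting's lemma: for large c the module is the direct sum of the kernel and the image of e^c,
    and indecomposability makes one of them zero. *)
Lemma bij_or_nilpotent (e : {linear M -> M}) :
  bijective e \/ exists k, forall x, iter k e x = 0.
Proof.
pose p k := linear_of (iter_linear e k).
have [||_ [[a <-] mina]] := @ranked_min _ _ _ rM
  [set S | exists k, p k @` setT = S] (p 0%N @` setT).
- by move=> _ [k <-]; apply/submodule_im/submodule_setT.
- by exists 0%N.
have [||_ [[b <-] maxb]] := @ranked_max _ _ _ rM
  [set S | exists k, [set x | p k x = 0] = S] [set x | p 0%N x = 0].
- by move=> _ [k <-]; apply: submodule_ker.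
- by exists 0%N.
have pD k l x : p (k + l)%N x = p k (p l x) by rewrite !linear_ofE iterD.
(* Images are stable from exponent a on, kernels from b on. The successor lets one factor e be split
   off on the right of e^c, which gives injectivity of e. *)
pose c := (a + b).+1.
have imc x : exists y, p c x = p (c + c)%N y.
  have /mina : exists k, p k @` setT = p (c + c)%N @` setT by exists (c + c)%N.
  have cE : c = (a + b.+1)%N by rewrite /c addnS.
  move=> h; have [||y _ E] := h _ (p a (p b.+1 x)).
  - move=> _ [y _ <-]; exists (p (b.+1 + c)%N y) => //.
    by rewrite -pD addnA -cE.
  - by exists (p b.+1 x).
  - by exists y; rewrite E -pD -cE.
have kerc x : p (c + c)%N x = 0 -> p c x = 0.
  have /maxb : exists k, [set x | p k x = 0] = [set x | p (c + c)%N x = 0].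
    by exists (c + c)%N.
  have cE : (c + c = (c + a.+1) + b)%N by rewrite {2}/c -addnA addSn.
  move=> h E; rewrite [LHS](_ : _ = p a.+1 (p b x)); last first.
    by rewrite -pD /c addSn.
  rewrite (h _ x E) ?linear0 //.
  move=> y y0; have {}y0 : p b y = 0 by [].
  by change (p (c + c)%N y = 0); rewrite cE pD y0 linear0.
have [||x|x|k0|k0] := @indec_complement [set x | p c x = 0] (p c @` setT).
- exact: submodule_ker.
- exact/submodule_im/submodule_setT.
- move=> Sx [y _ E]; rewrite -E; apply: kerc; rewrite pD E; exact: Sx.
- have [y E] := imc x; exists (x - p c y), (p c y); rewrite subrK; split=> //.
  by change (p c (x - p c y) = 0); rewrite linearB E pD subrr.
- left; have ec y : p c y = p (a + b)%N (e y) by rewrite !linear_ofE iterSr.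
  apply: inj_surj_bij.
    apply: ker0_inj => y y0; apply: k0.
    by change (p c y = 0); rewrite ec y0 linear0.
  move=> y; have [z hz] := imc y; exists (p (a + b)%N z).
  have -> : e (p (a + b)%N z) = p c z by [].
  apply/eqP; rewrite -subr_eq0; apply/eqP; apply: k0.
  by change (p c (p c z - y) = 0); rewrite linearB -pD hz subrr.
- by right; exists c => y; apply: k0; exists y.
Qed.

Lemma inj_bij (e : {linear M -> M}) : injective e -> bijective e.
Proof.
move=> ei; have [//|[k hk]] := bij_or_nilpotent e.
exfalso; apply: indM.1 => x; elim: k x hk => [|k IH] x hk; first exact: hk.
by apply: IH => y; apply: ei; rewrite linear0; apply: hk.
Qed.

Lemma surj_bij (e : {linear M -> M}) :
  (forall y, exists x, e x = y) -> bijective e.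
Proof.
move=> es; have [//|[k hk]] := bij_or_nilpotent e.
exfalso; apply: indM.1 => x; elim: k x hk => [|k IH] x hk; first exact: hk.
by apply: IH => y; have [z <-] := es y; rewrite -iterSr hk.
Qed.

Lemma comp_nonbij_l (e e' : {linear M -> M}) :
  ~ bijective e -> ~ bijective (e \o e').
Proof. by move=> ne /comp_bij_surj /surj_bij. Qed.

Lemma comp_nonbij_r (e e' : {linear M -> M}) :
  ~ bijective e' -> ~ bijective (e \o e').
Proof. by move=> ne /comp_bij_inj /inj_bij. Qed.

(** Locality of End M. If w inverts e + e', then w e is nilpotent, whereas it fixes every element
    killed by w e'; hence w e' is injective, thus bijective, and so is e'. *)
Lemma add_nonbij (e e' : {linear M -> M}) :
  ~ bijective e -> ~ bijective e' -> ~ bijective (e \+ e').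
Proof.
move=> ne ne' /bij_linv [w [uK Ku]].
have nw : ~ bijective (w \o e) by apply: comp_nonbij_r.
have [//|[k hk]] := bij_or_nilpotent (w \o e).
apply: ne'.
have /inj_bij : injective (w \o e').
  apply: ker0_inj => x /= x0.
  have fx : w (e x) = x.
    by rewrite -[RHS]uK /= linearD x0 addr0.
  rewrite -(hk x); elim: k {hk} => //= k <-; by rewrite fx.
apply: contraPP => ne'; exact: comp_nonbij_r.
Qed.

Lemma sum_nonbij (J : Type) (r : seq J) (e : J -> {linear M -> M}) :
  (forall i, ~ bijective (e i)) -> ~ bijective (fun x => \sum_(i <- r) e i x).
Proof.
move=> ne; elim: r => [|i r IH] b.
  apply: indM.1 => x; have := bij_inj b; apply; by rewrite !big_nil.
apply: (add_nonbij (ne i) (e' := linear_of (sum_linear r xpredT e))) => //.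
by apply: (eq_bij b) => x; rewrite big_cons.
Qed.
End Indecomposable.

Lemma ranked_proper (A : pzRingType) (M N : lmodType A) (f : {linear M -> N}) n :
  ranked N n -> injective f -> ~ (forall y, exists x, f x = y) ->
  exists2 m, n = m.+1 & ranked M m.
Proof.
move=> [rk [h1 h2]] fi nf.
have lt S : submodule S -> (rk (f @` S) < n)%N.
  move=> hS; apply: leq_trans (h1 setT); apply: h2 => //; [exact: submodule_im|].
  by move=> h; apply: nf => y; have [|x _ <-] := h y; [|exists x].
case: n h1 lt => [|m] h1 lt; first by have := lt _ (submodule_setT M).
(* The bound m is known only for images of submodules, yet a rank must be bounded on all sets; hence
   the default 0 elsewhere. *)
exists m => //; exists (fun S => if `[< submodule S >] then rk (f @` S) else 0%N).
split=> [S|S S' hS hS' SS' n1].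
  by case: asboolP => // hS; rewrite -ltnS; apply: lt.
rewrite !asboolT //; apply: h2;
  [exact: submodule_im|exact: submodule_im|exact: image_subset|].
by move=> h; apply: n1 => x S'x; have [|y Sy /fi <-] := h (f x); first by exists x.
Qed.

(** Biproduct equations with projections [a] and inclusions [b]. An arbitrary finite index type lets
    two decompositions be joined over a disjoint sum. *)
Definition decomposes (A : pzRingType) (I : indcat A) (X : lmodType A)
    (J : finType) (F : J -> I) (a : forall t, {linear X -> ind_mod (F t)})
    (b : forall t, {linear ind_mod (F t) -> X}) : Prop :=
  [/\ forall x, \sum_t b t (a t x) = x,
      forall t x, a t (b t x) = x
    & forall s t x, s <> t -> a s (b t x) = 0].

Lemma decomposition (A : pzRingType) (I : indcat A) (X : lmodType A) n :
  fin_gen X -> ranked X n ->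
  exists (J : finType) (F : J -> I) (a : forall t, {linear X -> ind_mod (F t)})
    (b : forall t, {linear ind_mod (F t) -> X}), decomposes a b.
Proof.
elim: n {-2}n (leqnn n) X => [|n0 IH] n ln X fX rX; last first.
  have [zX|nzX] := pselect (zero_mod X).
    exists void, (fun t : void => match t with end),
      (fun t : void => match t with end), (fun t : void => match t with end).
    by split=> [x|[]|[]]; rewrite (zX x) [LHS]zX.
  have [iX|niX] := pselect (indecomposable X).
    have [Y [f bf]] := ind_dense I fX iX; have [g [fK gK]] := bij_linv bf.
    exists unit, (fun=> Y), (fun=> f), (fun=> g); split=> [x|t x|[] []] //.
    by rewrite (big_pred1 tt) // => -[].
  have [X1 [X2 [[f bf] nz1 nz2]]] :
      exists X1 X2 : lmodType A, [/\ iso_mod X ((X1 * X2)%type : lmodType A),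
        ~ zero_mod X1 & ~ zero_mod X2].
    apply: contrapT => h; apply: niX; split=> // X1 X2 iso.
    have [|n1] := pselect (zero_mod X1); first by left.
    have [|n2] := pselect (zero_mod X2); first by right.
    by exfalso; apply: h; exists X1, X2.
  have [g [fK gK]] := bij_linv bf.
  have li1 : linear (fun x : X1 => (x, 0) : X1 * X2).
    by move=> a x y; congr pair; rewrite /= scaler0 addr0.
  have li2 : linear (fun x : X2 => (0, x) : X1 * X2).
    by move=> a x y; congr pair; rewrite /= scaler0 addr0.
  pose i1 : {linear X1 -> X} := g \o linear_of li1.
  pose i2 : {linear X2 -> X} := g \o linear_of li2.
  pose p1 : {linear X -> X1} := (fst : {linear (X1 * X2)%type -> X1}) \o f.
  pose p2 : {linear X -> X2} := (snd : {linear (X1 * X2)%type -> X2}) \o f.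
  have p1i1 x : p1 (i1 x) = x by rewrite /p1 /i1 /= gK.
  have p2i2 x : p2 (i2 x) = x by rewrite /p2 /i2 /= gK.
  have p1i2 x : p1 (i2 x) = 0 by rewrite /p1 /i2 /= gK.
  have p2i1 x : p2 (i1 x) = 0 by rewrite /p2 /i1 /= gK.
  have ip x : i1 (p1 x) + i2 (p2 x) = x.
    rewrite -[RHS]fK /i1 /i2 /p1 /p2 /= -linearD; congr (g _).
    by case: (f x) => u v; congr pair; rewrite /= ?addr0 ?add0r.
  have [|m1 e1 r1] := ranked_proper rX (can_inj p1i1).
    move=> h; apply: nz2 => y; have [x hx] := h (i2 y).
    by rewrite -(p2i2 y) -hx p2i1.
  have [|m2 e2 r2] := ranked_proper rX (can_inj p2i2).
    move=> h; apply: nz1 => y; have [x hx] := h (i1 y).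
    by rewrite -(p1i1 y) -hx p1i2.
  have f1 : fin_gen X1 by apply: (fin_gen_inj rX (can_inj p1i1)).
  have f2 : fin_gen X2 by apply: (fin_gen_inj rX (can_inj p2i2)).
  have [|J1 [F1 [a1 [b1 [h11 h12 h13]]]]] := IH m1 _ X1 f1 r1.
    by move: ln; rewrite e1.
  have [|J2 [F2 [a2 [b2 [h21 h22 h23]]]]] := IH m2 _ X2 f2 r2.
    by move: ln; rewrite e2.
  pose F t := match t with inl s => F1 s | inr s => F2 s end.
  pose a t : {linear X -> ind_mod (F t)} :=
    match t with inl s => a1 s \o p1 : {linear _ -> _}
               | inr s => a2 s \o p2 : {linear _ -> _} end.
  pose b t : {linear ind_mod (F t) -> X} :=
    match t with inl s => i1 \o b1 s : {linear _ -> _}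
               | inr s => i2 \o b2 s : {linear _ -> _} end.
  exists (J1 + J2)%type, F, a, b.
  split.
  - move=> x; rewrite big_sumType /= -[RHS]ip; congr (_ + _).
      by rewrite -[in RHS](h11 (p1 x)) [RHS]linear_sum; apply: eq_bigr.
    by rewrite -[in RHS](h21 (p2 x)) [RHS]linear_sum; apply: eq_bigr.
  - by move=> [t|t] x; rewrite /= gK /= ?h12 ?h22.
  - move=> [s|s] [t|t] x st; rewrite /= gK /= ?linear0 //.
      by apply: h13 => e; apply: st; rewrite e.
    by apply: h23 => e; apply: st; rewrite e.
move: ln; rewrite leqn0 => /eqP n0; move: rX; rewrite n0 => -[rk [h1 h2]].
exists void, (fun t : void => match t with end),
  (fun t : void => match t with end), (fun t : void => match t with end).
have zX : zero_mod X.
  move=> x; apply: contrapT => nx.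
  have lt : (rk [set 0%R] < rk setT)%N.
    apply: h2 => //; [exact: submodule_set0|by move=> h; apply: nx; apply: (h x)].
  by have := leq_trans lt (h1 _).
by split=> [x|[]|[]]; rewrite (zX x) [LHS]zX.
Qed.

(** * Traces and splitting *)

Lemma central_linear (R : comPzRingType) (A : algType R) (M : lmodType A) (r : R) :
  linear (fun x : M => (r%:A : A) *: x).
Proof. by move=> a x y; rewrite scalerDr !scalerA mulr_algl mulr_algr. Qed.

(* Nakayama's lemma over End M: M is finitely generated over the image of R in
   End M, and a generator lying in V plus the radical multiples of all of them
   can be dropped. *)
Lemma endo_nakayama (R : comPzRingType) (A : algType R) (M : lmodType A)
    (V : set M) :
  artin_algebra A -> fin_gen M -> indecomposable M -> submodule V ->
  (forall (e : {linear M -> M}) x, V x -> V (e x)) ->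
  (forall x, smallest (@submodule A M)
     (V `|` [set y | exists (e : {linear M -> M}) z, ~ bijective e /\ e z = y]) x) ->
  forall x, V x.
Proof.
move=> hA fM iM hV eV gen.
have [n rM] := artin_ranked hA fM.
pose good k := exists m : 'I_k -> M, forall x,
  exists (v : M) (e : 'I_k -> {linear M -> M}), V v /\ x = v + \sum_i e i (m i).
(* Generators over R suffice, since scalars from R act on M by A-linear endomorphisms. *)
have [k hk] : exists k, good k.
  have [k [g hg]] := restr_fin_gen hA.2 fM; exists k, g => x.
  have [c hc] := hg x.
  exists 0, (fun i => linear_of (central_linear (M := M) (c i))); split;
    first exact: submodule0.
  by rewrite add0r.
suff : good 0%N.
  by move=> [m hm] x; have [v [e [Vv ->]]] := hm x; rewrite big_ord0 addr0.
elim: k hk => // k IH [m hm]; apply: IH.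
pose Q x := exists (v : M) (e : 'I_k.+1 -> {linear M -> M}),
  [/\ V v, forall i, ~ bijective (e i) & x = v + \sum_i e i (m i)].
have nb0 : ~ bijective (\0 : {linear M -> M}).
  by move=> /bij_inj inj; apply: iM.1 => x; apply: inj.
have QV v : V v -> Q v.
  move=> Vv; exists v, (fun=> \0); split=> //.
  by rewrite big1 ?addr0.
have QD x y : Q x -> Q y -> Q (x + y).
  move=> [v [e [Vv ne ->]]] [w [f [Vw nf ->]]].
  exists (v + w), (fun i => e i \+ f i : {linear M -> M}); split.
  - exact: submoduleD.
  - by move=> i; apply: (add_nonbij iM rM).
  - by rewrite addrACA -big_split.
have Qj (j : {linear M -> M}) y : ~ bijective j -> Q (j y).
  move=> nj; have [v [e [Vv ->]]] := hm y.
  exists (j v), (fun i => j \o e i : {linear M -> M}); split; first exact: eV.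
    by move=> i; apply: (comp_nonbij_l iM rM).
  by rewrite linearD linear_sum.
have Qall x : Q x.
  suff : [set y | forall a : A, Q (a *: y)] x by move=> /(_ 1); rewrite scale1r.
  have := gen x; apply: smallest_sub.
    split=> [a|a u v hu hv b]; first by rewrite scaler0; exact: QV (submodule0 hV).
    by rewrite scalerDr scalerA; apply: QD.
  move=> y [Vy a|[e [z [ne <-]]] a]; first exact: QV (submoduleZ a hV Vy).
  by rewrite -linearZ; apply: Qj.
(* The coefficient j of the last generator in its own expansion is non-bijective, so id - j is
   bijective by locality, and the equation can be solved for that generator. *)
have [v [e [Vv ne em]]] := Qall (m ord_max).
pose j := e ord_max.
pose d : {linear M -> M} := idfun \- j.
have bd : bijective d.
  apply: contrapT => nd; apply: (add_nonbij iM rM (ne ord_max) nd).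
  apply: (eq_bij (f := id)); first by exists id.
  by move=> x; rewrite /= addrC subrK.
have [w [dK Kd]] := bij_linv bd.
have mE : m ord_max = w v + \sum_(i < k) w (e (widen_ord (leqnSn k) i) (m
  (widen_ord (leqnSn k) i))).
  rewrite -linear_sum -linearD; apply: (canRL dK).
  by rewrite /d /= {1}em big_ord_recr /= addrA addrK.
exists (fun i => m (widen_ord (leqnSn k) i)) => x.
have [v' [f [Vv' ->]]] := hm x.
exists (v' + f ord_max (w v)),
  (fun i => f (widen_ord (leqnSn k) i) \+ (f ord_max \o (w \o e (widen_ord
    (leqnSn k) i)))
     : {linear M -> M}); split.
  by apply: submoduleD => //; exact: (eV _ _ (eV _ _ Vv)).
rewrite big_ord_recr /= mE linearD linear_sum big_split /= -!addrA.
by congr (_ + _); rewrite addrCA.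
Qed.

Section Traces.
Variables (A : pzRingType) (I : indcat A).
Implicit Types (D : set I) (M N : lmodType A).

Lemma submodule_trace D M : submodule (trace D M).
Proof. exact: submodule_smallest. Qed.

Lemma trace_mem D M (X : I) (f : {linear ind_mod X -> M}) x :
  D X -> trace D M (f x).
Proof. by move=> DX; apply: smallest_gen; exists X, f, x. Qed.

Lemma trace_sub D M (S : set M) : submodule S ->
  (forall (X : I) (f : {linear ind_mod X -> M}) x, D X -> S (f x)) ->
  trace D M `<=` S.
Proof.
by move=> hS h; apply: smallest_sub => // _ [X [f [x [DX <-]]]]; apply: h.
Qed.

Lemma trace_map D M N (f : {linear M -> N}) x : trace D M x -> trace D N (f x).
Proof.
apply: (trace_sub (S := f @^-1` trace D N)).
  by apply: (submodule_preim f); apply: submodule_trace.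
by move=> X g y DX; apply: (trace_mem (f \o g)).
Qed.

Lemma trace_trans D D' M :
  (forall X, D X -> forall x, trace D' (ind_mod X) x) ->
  trace D M `<=` trace D' M.
Proof.
move=> h; apply: trace_sub; first exact: submodule_trace.
by move=> X f x DX; apply: trace_map; apply: h.
Qed.

Lemma cover_trace (D C : set I) (X : I) :
  is_cover D C -> C X -> forall x, trace D (ind_mod X) x.
Proof.
move=> [_ h] CX x; have [Y [[n [F [DF [s [r sK]]]]] [f sf]]] := h X CX.
have [y _ <-] := sf x Logic.I; rewrite -(sK y).
pose Q (Z : lmodType A) := forall (g : {linear Z -> ind_mod X}) z,
  trace D (ind_mod X) (g z).
suff hQ : Q (dirsum (fun k => ind_mod (F k))) by apply: (hQ (f \o r) (s y)).
apply: big_ind.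
- by move=> g z; rewrite (_ : z = 0) ?linear0;
  [exact: submodule0 (submodule_trace _ _)|apply/rowP => -[]].
- move=> Z1 Z2 h1 h2 g [z1 z2].
  have l1 : linear (fun z : Z1 => g (z, 0)).
    move=> a u v; rewrite -linearP; congr (g _).
    by congr pair; rewrite /= scaler0 addr0.
  have l2 : linear (fun z : Z2 => g (0, z)).
    move=> a u v; rewrite -linearP; congr (g _).
    by congr pair; rewrite /= scaler0 addr0.
  have -> : g (z1, z2) = linear_of l1 z1 + linear_of l2 z2.
    by rewrite !linear_ofE -linearD; congr (g _); congr pair; rewrite /= ?addr0 ?add0r.
  by apply: (submoduleD (submodule_trace _ _)); [apply: h1|apply: h2].
- by move=> k _ g z; apply: trace_mem.
Qed.

Lemma dirsum_univ M n (F : 'I_n -> I) (f : forall k, {linear ind_mod (F k) -> M}) :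
  exists h : {linear dirsum (fun k => ind_mod (F k)) -> M},
    forall k x, exists v, h v = f k x.
Proof.
elim: n F f => [|n IH] F f.
  by exists \0 => -[].
have [h hh] := IH (fun k => F (lift ord0 k)) (fun k => f (lift ord0 k)).
rewrite /dirsum big_ord_recl.
have lg : linear (fun p : (ind_mod (F ord0) * dirsum (fun k =>
  ind_mod (F (lift ord0 k))))%type =>
    f ord0 p.1 + h p.2).
  by move=> a [x y] [x' y']; rewrite /= !linearP scalerDr addrACA.
exists (linear_of lg) => k; case: (unliftP ord0 k) => [j ->|->] x.
  by have [v hv] := hh j x; exists (0, v); rewrite linear_ofE /= linear0 add0r.
by exists (x, 0); rewrite linear_ofE /= linear0 addr0.
Qed.

Lemma trace_cover D M : fin_gen M -> (forall x, trace D M x) ->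
  exists X : lmodType A, in_add D X /\
    exists f : {linear X -> M}, set_surj [set: X] [set: M] f.
Proof.
move=> /fin_gen_lspan [s hs] ht.
pose T := {X : I & {linear ind_mod X -> M}}.
pose inside n (G : 'I_n -> T) (S : set M) := forall k y, S (projT2 (G k) y).
(* Finitely many maps from D whose images together generate every element of s. Testing against all
   submodules S avoids writing elements as explicit sums. *)
pose covered (s : seq M) := exists n (G : 'I_n -> T),
  (forall k, D (projT1 (G k))) /\
  forall S, submodule S -> inside n G S -> forall x, x \in s -> S x.
have comb s1 s2 : covered s1 -> covered s2 -> covered (s1 ++ s2).
  move=> [n1 [G1 [D1 h1]]] [n2 [G2 [D2 h2]]].
  exists (n1 + n2)%N, (fun k => match fintype.split k with inl i => G1 i |
    inr i => G2 i end).
  split=> [k|S hS iS x]; first by case: (fintype.split k).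
  rewrite mem_cat => /orP []; [apply: h1|apply: h2] => // k y.
    by have := iS (lshift n2 k); rewrite -[lshift n2 k]/(unsplit (inl k)) unsplitK.
  by have := iS (rshift n1 k); rewrite -[rshift n1 k]/(unsplit (inr k)) unsplitK.
have cov1 x : covered [:: x].
  have := ht x; apply: (trace_sub (S := [set x | covered [:: x]])).
    split.
      exists 0%N, (fun k : 'I_0 => match notF (ltn_ord k) with end).
      split=> [[]|S hS _ y] //; rewrite inE => /eqP ->; exact: submodule0.
    move=> a u v cu cv; have [n [G [DG hG]]] := comb _ _ cu cv.
    exists n, G; split=> // S hS iS y; rewrite inE => /eqP ->.
    by apply: hS.2; apply: (hG S hS iS); rewrite !inE eqxx ?orbT.
  move=> X f y DX; exists 1%N, (fun=> existT _ X f); split=> // S hS iS z.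
  by rewrite inE => /eqP ->; apply: (iS ord0).
have [n [G [DG hG]]] : covered s.
  elim: (s) => [|x s' IH]; last exact: (comb [:: x] s').
  by have [n [G [DG _]]] := cov1 0; exists n, G.
have [h hh] := dirsum_univ (fun k => projT2 (G k)).
exists (dirsum (fun k => ind_mod (projT1 (G k)))); split.
  by exists n, (fun k => projT1 (G k)); split=> //; exists idfun, idfun.
exists h => x _; suff : (h @` setT) x by [].
have : lspan s x by rewrite hs.
apply: lspan_min; first exact/submodule_im/submodule_setT.
apply: hG; first exact/submodule_im/submodule_setT.
by move=> k y; have [v hv] := hh k y; exists v.
Qed.
End Traces.

(** * Layers of the partition and radical maps between them *)

Definition layers_from (A : pzRingType) (I : indcat A) (P : natinf -> set I)
    (i : nat) : set I :=
  \bigcup_(k in [set k | le_natinf i k]) P k.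

Definition nonsplit_trace (A : pzRingType) (I : indcat A) (D : set I) (M : I) :
    set (ind_mod M) :=
  smallest (@submodule A (ind_mod M))
    [set y | exists (X : I) (f : {linear ind_mod X -> ind_mod M}) x,
       [/\ D X, ~ bijective f & f x = y]].

Lemma bij_ind_eq (A : pzRingType) (I : indcat A) (X Y : I)
    (f : {linear ind_mod X -> ind_mod Y}) : bijective f -> X = Y.
Proof. by move=> bf; apply: ind_skeletal; exists f. Qed.

Lemma layer_disjoint (A : pzRingType) (I : indcat A) (P : natinf -> set I)
    (X : I) k l :
  postprojective_partition P -> P k X -> P l X -> k = l.
Proof. by move=> [tr _ _] hk hl; apply: tr => //; exists X. Qed.

Lemma layer_exists (A : pzRingType) (I : indcat A) (P : natinf -> set I) (X : I) :
  postprojective_partition P -> exists k, P k X.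
Proof.
move=> [_ cov _]; have : [set: I] X by [].
by rewrite -cov => -[k _ hk]; exists k.
Qed.

Lemma layer_trace (A : pzRingType) (I : indcat A) (P : natinf -> set I)
    (X : I) i :
  postprojective_partition P -> layers_from P i X ->
  forall x, trace (P (Fin i)) (ind_mod X) x.
Proof. by move=> [_ _ h] hX; have [_ [c _]] := h i; apply: cover_trace c hX. Qed.

(* If M is the sum of the images of such maps then, by Nakayama, it is already
   generated by P_i \ M, so that P_i \ M is a smaller cover. *)
Lemma layer_splitting (R : comPzRingType) (A : algType R) (I : indcat A)
    (P : natinf -> set I) (i : nat) (M : I) :
  artin_algebra A -> postprojective_partition P -> P (Fin i) M ->
  ~ forall x : ind_mod M, nonsplit_trace (layers_from P i) x.
Proof.
move=> hA hP PM full.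
pose D := P (Fin i) `\ M.
have DP : D `<=` P (Fin i) by move=> X [].
have V x : trace D (ind_mod M) x.
  apply: (endo_nakayama hA (ind_fin_gen M) (ind_indecomposable M)
    (submodule_trace D _)).
    by move=> e y; apply: trace_map.
  move=> {}x; have := full x; apply: smallest_sub; first exact: submodule_smallest.
  set S := smallest _ _; move=> _ [X [f [y [DX nf <-]]]].
  have := layer_trace hP DX y.
  apply: (trace_sub (S := f @^-1` S)).
    by apply: submodule_preim; apply: submodule_smallest.
  move=> W w z PW; rewrite /preimage /=.
  (* For W = M the composite f w is an endomorphism of M, and it is not bijective, as otherwise f
     would be a split epimorphism from an indecomposable, hence bijective. Every other W already
     lies in D. *)
  have [WM|WM] := pselect (W = M).
    subst W; apply: smallest_gen; right; exists (f \o w), z; split=> // bfw.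
    apply: nf; have [u [uK Ku]] := bij_linv bfw.
    apply: (split_epi_bij (ind_indecomposable X) (ind_indecomposable M).1).
    by exists (w \o u).
  by apply: smallest_gen; left; apply: (trace_mem (f \o w)).
have [_ _ /(_ i) [_ [[_ cov] min]]] := hP.
apply: (min D); first by split=> // /(_ M PM) [_]; apply.
split=> [X [PX _]|X hX]; first by exists (Fin i) => //=.
apply: trace_cover; first exact: ind_fin_gen.
move=> x; apply: (trace_trans (D := P (Fin i))); last exact: layer_trace.
move=> Y PY; have [-> //|YM] := pselect (Y = M).
by move=> y; apply: (trace_mem idfun).
Qed.

(** * Almost split sequences *)

Lemma row_lift (A : pzRingType) n (Y Q : lmodType A) (q : {linear Y -> Q})
    (h : {linear 'rV[A]_n -> Q}) :
  (forall y, exists x, q x = y) ->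
  exists h' : {linear 'rV[A]_n -> Y}, forall x, q (h' x) = h x.
Proof.
move=> qs; have [y hy] := choice (fun i => qs (h (delta_mx 0 i))).
have l : linear (fun x : 'rV[A]_n => \sum_i x 0 i *: y i).
  move=> a u v; rewrite scaler_sumr -big_split; apply: eq_bigr => i _.
  by rewrite /= !mxE scalerDl scalerA.
exists (linear_of l) => x;
  rewrite linear_ofE linear_sum [in RHS](row_sum_delta x) linear_sum.
by apply: eq_bigr => i _; rewrite !linearZ hy.
Qed.

Lemma row_cover (A : pzRingType) (N : lmodType A) : fin_gen N ->
  exists n (p : {linear 'rV[A]_n -> N}), forall y, exists x, p x = y.
Proof.
move=> [n [g hg]].
have l : linear (fun x : 'rV[A]_n => \sum_i x 0 i *: g i).
  move=> a u v; rewrite scaler_sumr -big_split; apply: eq_bigr => i _.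
  by rewrite /= !mxE scalerDl scalerA.
exists n, (linear_of l) => y; have [c ->] := hg y.
by exists (\row_i c i); rewrite linear_ofE; apply: eq_bigr => i _; rewrite mxE.
Qed.

Lemma row_fin_gen (A : pzRingType) n : fin_gen ('rV[A]_n : lmodType A).
Proof.
exists n, (delta_mx 0) => x; exists (fun i => x 0 i); exact: row_sum_delta.
Qed.

Lemma ffun_fin_gen (R : pzRingType) (M : lmodType R) n :
  fin_gen M -> fin_gen ({ffun 'I_n -> M} : lmodType R).
Proof.
move=> /fin_gen_lspan [s hs]; apply/fin_gen_lspan.
pose d k (a : M) : {ffun 'I_n -> M} := [ffun l => if l == k then a else 0].
exists [seq d k a | k <- enum 'I_n, a <- s].
set S := lspan _; have hS : submodule S by apply: submodule_lspan.
apply/seteqP; split=> // w _.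
have -> : w = \sum_k d k (w k).
  apply/ffunP => l; rewrite sum_ffunE (bigD1 l) //= ffunE eqxx big1 ?addr0 //.
  by move=> k kl; rewrite ffunE eq_sym (negPf kl).
apply: (@submodule_sum _ _ S _ _ xpredT (fun k => d k (w k)) hS) => k _.
have : lspan s (w k) by rewrite hs.
apply: (lspan_min (S := [set a | S (d k a)])).
  split=> [|a u v hu hv].
    rewrite /= (_ : d k 0 = 0); first exact: submodule0.
    by apply/ffunP => l; rewrite !ffunE if_same.
  rewrite /= (_ : d k _ = a *: d k u + d k v); first exact: hS.2.
  by apply/ffunP => l; rewrite !ffunE; case: ifP; rewrite ?scaler0 ?addr0.
by move=> a sa; apply: lspan_mem; apply: allpairs_f; rewrite ?mem_enum.
Qed.

(* If F is free and O is the kernel of an epimorphism F -> N, the maps O -> Z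
   modulo those that extend to F form Ext^1(N, Z). *)
Definition extends (A : pzRingType) (F O Z : lmodType A) (io : {linear O -> F})
    (phi : {linear O -> Z}) : Prop :=
  exists h : {linear F -> Z}, forall x, h (io x) = phi x.

(** The class of phi in Ext^1 is nonzero but dies in Z/S for every nonzero S. The second clause uses
    an extension F -> Z/S already lifted to Z, which is harmless for the free F of the
    applications. *)
Definition minimal_obstruction (A : pzRingType) (F O Z : lmodType A)
    (io : {linear O -> F}) (phi : {linear O -> Z}) : Prop :=
  ~ extends io phi /\
  forall S : set Z, submodule S -> (exists x, S x /\ x <> 0) ->
    exists h : {linear F -> Z}, forall x, S (phi x - h (io x)).

Section Action.
Variables (R : comPzRingType) (A : algType R) (Z : lmodType A) (m : nat).

(** The R-bilinear pairing A^m x Z -> Z^m; fixing z gives the element of Hom_R(A^m, Z^m) that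
    represents z. *)
Definition tuple_act (w : {ffun 'I_m -> A}) (z : restr Z) :
    {ffun 'I_m -> restr Z} := [ffun k => (w k : A) *: (z : Z)].

Lemma tuple_actDl r w w' z :
  tuple_act (r *: w + w') z = r *: tuple_act w z + tuple_act w' z.
Proof.
apply/ffunP => k; rewrite !ffunE scalerDl -mulr_algl -scalerA //.
Qed.

Lemma tuple_actDr (r : R) w z z' :
  tuple_act w (r *: z + z') = r *: tuple_act w z + tuple_act w z'.
Proof.
apply/ffunP => k; rewrite !ffunE scalerDr; congr (_ + _).
by rewrite !restr_scaleE !scalerA mulr_algl mulr_algr.
Qed.
End Action.

(* If H is maximal among the R-submodules of Z^m that contain the coboundaries
   but not the obstruction class, then every nonzero R-submodule of Z^m/H
   contains that class; hence Hom_R(A^m, Z^m/H) is no longer than A^m, and Z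
   embeds into it by minimality. *)
Lemma minimal_obstruction_series (R : comPzRingType) (A : algType R)
    (n : nat) (O : lmodType A) (io : {linear O -> 'rV[A]_n}) :
  artin_algebra A -> fin_gen O ->
  exists k, forall (Z : lmodType A) (phi : {linear O -> Z}),
    minimal_obstruction io phi -> series [set 0 : restr Z] setT k.
Proof.
move=> hA [m [g hg]].
have [k0 hk0] := artinian_series hA.1.
have [k hk] := fin_gen_series hk0 (@ffun_fin_gen R A m hA.2).
exists k => Z phi [nex min].
(* A map on O is recorded by its values on the generators; B collects the tuples of the maps that
   extend to the free module. *)
pose zeta : {ffun 'I_m -> restr Z} := [ffun l => phi (g l)].
pose B : set {ffun 'I_m -> restr Z} :=
  [set v | exists h : {linear 'rV[A]_n -> Z}, forall l, v l = h (io (g l))].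
have subB : submodule B.
  split; first by exists \0 => l; rewrite ffunE.
  move=> r u v [h hu] [h' hv].
  exists ((linear_of (central_linear (M := Z) r) \o h) \+ h') => l.
  by rewrite !ffunE hu hv.
have nBz : ~ B zeta.
  move=> [h hz]; apply: nex; exists h => x; have [c ->] := hg x.
  rewrite !linear_sum; apply: eq_bigr => l _; rewrite !linearZ.
  by have := hz l; rewrite ffunE => <-.
have [H [smH BH nHz Hmax]] := maximal_avoiding subB nBz.
(* The annihilator of S under the pairing with values in Z^m/H. It reverses inclusions, and it will
   turn a series of A^m into one of Z of the same length. *)
pose G (S : set {ffun 'I_m -> A}) : set (restr Z) :=
  [set z | forall w, S w -> H (tuple_act w z)].
have smG S : submodule (G S).
  split=> [w _|r u v hu hv w Sw].
    rewrite (_ : tuple_act w 0 = 0); first exact: (submodule0 smH).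
    by apply/ffunP => l; rewrite !ffunE scaler0.
  by rewrite tuple_actDr; apply: smH.2; [apply: hu|apply: hv].
have stepG S T : step S T -> step (G T) (G S).
  move=> [smS smT ST st]; split=> //.
    by move=> z hz w Sw; apply: hz; apply: ST.
  move=> z z' Gz Gz' nGz nGz'.
  have bad y : ~ G T y -> exists w, T w /\ ~ H (tuple_act w y).
    move=> ny; apply: contrapT => h; apply: ny => w Tw.
    by apply: contrapT => nh; apply: h; exists w.
  have [w1 [Tw1 nw1]] := bad z nGz; have [w [Tw nw']] := bad z' nGz'.
  have nSw : ~ S w by move=> Sw; apply: nw'; apply: Gz'.
  have nw : ~ H (tuple_act w z).
    move=> Hw; have nS1 : ~ S w1 by move=> Sw; apply: nw1; apply: Gz.
    have [u Su] := st w1 w Tw1 Tw nS1 nSw.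
    apply: nw1; rewrite -(subrK (u *: w) w1) addrC tuple_actDl.
    by apply: smH.2 => //; apply: Gz.
  have [r1 [h1 [Hh1 e1]]] := Hmax _ nw; have [r2 [h2 [Hh2 e2]]] := Hmax _ nw'.
  have nr1 : ~ S (r1 *: w).
    move=> Sr; apply: nHz; rewrite e1; apply: submoduleD => //.
    have -> : r1 *: tuple_act w z = tuple_act (r1 *: w + 0) z.
      rewrite tuple_actDl (_ : tuple_act 0 z = 0) ?addr0 //.
      by apply/ffunP => l; rewrite !ffunE scale0r.
    by rewrite addr0; apply: Gz.
  (* Since r1 w is outside S, r1 acts invertibly on T/S and u1 undoes it. As r1 (w z) and r2 (w z')
     both equal zeta modulo H, the multiplier of z' is u1 r2. *)
  have [u1 Su1] := st w (r1 *: w) Tw (submoduleZ r1 smT Tw) nSw nr1.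
  exists (u1 * r2) => t Tt.
  have -> : tuple_act t (z - (u1 * r2) *: z') =
      tuple_act t z - (u1 * r2) *: tuple_act t z'.
    by rewrite addrC -scaleNr tuple_actDr scaleNr addrC.
  have key : H (tuple_act w z - (u1 * r2) *: tuple_act w z').
    have -> : tuple_act w z = u1 *: (r1 *: tuple_act w z)
        + tuple_act (w - u1 *: (r1 *: w)) z.
      rewrite -{1}(subrK (u1 *: (r1 *: w)) w) addrC scalerA tuple_actDl.
      by rewrite scalerA.
    have -> : r1 *: tuple_act w z = r2 *: tuple_act w z' + (h2 - h1).
      by apply/eqP; rewrite addrA -e2 e1 addrK.
    have aux (U : zmodType) (x y t0 : U) : x + y + t0 - x = y + t0.
      by rewrite addrC !addrA addNr add0r.
    rewrite scalerDr scalerA aux.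
    by apply: (submoduleD smH); [apply: (submoduleZ _ smH);
      apply: (submoduleB smH) | apply: Gz].
  have [St|nSt] := pselect (S t).
    by apply: (submoduleB smH); [apply: Gz|apply: (submoduleZ _ smH); apply: Gz'].
  have [u Su] := st t w Tt Tw nSt nSw.
  have e y : tuple_act t y = u *: tuple_act w y + tuple_act (t - u *: w) y.
    by rewrite -tuple_actDl addrC subrK.
  have comm v : (u1 * r2) *: (u *: v) = u *: ((u1 * r2) *: v) :> {ffun 'I_m -> restr Z}.
    by rewrite !scalerA mulrC.
  rewrite !e scalerDr opprD addrACA comm -scalerBr.
  apply: (submoduleD smH); first exact: submoduleZ.
  by apply: (submoduleB smH); [apply: Gz|apply: (submoduleZ _ smH); apply: Gz'].
have ser K T l : series K T l -> series (G T) (G K) l.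
  elim=> [|S U i _ IH st]; first exact: series0.
  by rewrite -add1n; apply: series_trans IH; apply/series1/stepG.
have := ser _ _ _ hk; congr (series _ _ _); last first.
  apply/seteqP; split=> // z _ w ->.
  rewrite (_ : tuple_act 0 z = 0); first exact: (submodule0 smH).
  by apply/ffunP => l; rewrite !ffunE scale0r.
apply/seteqP; split=> [z Gz|_ ->]; last exact: (submodule0 (smG _)).
(* [G setT] is an A-submodule. If it were nonzero, minimality would correct phi by some h into it;
   pairing the corrected values with the unit vectors then puts zeta - v into H, hence zeta too. *)
apply: contrapT => nz; have [||h hh] := min (G setT).
- split=> [|a u v hu hv w _]; first exact: (submodule0 (smG _)).
  rewrite (_ : tuple_act w _ = tuple_act [ffun l => w l * a] u + tuple_act w v).
    by apply: (submoduleD smH); [apply: hu|apply: hv].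
  by apply/ffunP => l; rewrite !ffunE scalerDr scalerA.
- by exists z.
apply: nHz.
pose v : {ffun 'I_m -> restr Z} := [ffun l => h (io (g l))].
rewrite -(subrK v zeta); apply: (submoduleD smH); last first.
  by apply: BH; exists h => l; rewrite ffunE.
pose d (l : 'I_m) : {ffun 'I_m -> A} := [ffun i => if i == l then 1 else 0].
have -> : zeta - v = \sum_l tuple_act (d l) (phi (g l) - h (io (g l)) : Z).
  apply/ffunP => i; rewrite sum_ffunE (bigD1 i) //= big1 ?addr0.
    by rewrite !ffunE eqxx scale1r.
  by move=> l li; rewrite !ffunE eq_sym (negPf li) scale0r.
apply: (@submodule_sum _ _ H _ _ xpredT (fun l => tuple_act (d l) _) smH) => l _.
exact: hh.
Qed.

(** Divide by a submodule maximal among those modulo which the class survives; the freeness of the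
    row module turns extensions to the quotient into maps to Z. *)
Lemma minimal_quotient (A : pzRingType) n (O Z : lmodType A)
    (io : {linear O -> 'rV[A]_n}) (phi : {linear O -> Z}) k :
  ranked Z k -> ~ extends io phi ->
  exists (Q : lmodType A) (q : {linear Z -> Q}),
    (forall y, exists x, q x = y) /\ minimal_obstruction io (q \o phi).
Proof.
move=> rZ nex.
have [||S [[hS nS] maxS]] := @ranked_max _ _ _ rZ
  [set S | submodule S /\ ~ exists h : {linear 'rV[A]_n -> Z},
     forall x, S (phi x - h (io x))] [set 0].
- by move=> S [].
- split; first exact: submodule_set0.
  by move=> [h hh]; apply: nex; exists h => x; apply/esym/eqP;
    rewrite -subr_eq0; apply/eqP/hh.
have [Q [q [qs hq]]] := quot_exists hS.
exists Q, q; split=> //; split.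
  move=> [h' hh']; have [h hh] := row_lift h' qs.
  by apply: nS; exists h => x; apply/hq; rewrite linearB hh hh' subrr.
move=> T hT [y [Ty ny]]; apply: contrapT => nT.
have [x xy] := qs y; apply: ny; rewrite -xy; apply/hq.
apply: (maxS (q @^-1` T)).
- split; first exact: submodule_preim.
  move=> [h hh]; apply: nT; exists (q \o h) => z.
  by have := hh z; rewrite /preimage /= linearB.
- by move=> z /hq; rewrite /preimage /= => ->; apply: submodule0.
- by rewrite /preimage /= xy.
Qed.

(** A lower bound for the length, to be played against the upper bound [ranked]. *)
Definition strict_chain (A : pzRingType) (M : lmodType A) (k : nat) : Prop :=
  exists S : nat -> set M, (forall i, submodule (S i)) /\
    forall i, (i < k)%N -> S i `<=` S i.+1 /\ ~ S i.+1 `<=` S i.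

(* Take a minimal obstruction of maximal length: a map g out of Z along which it
   remains an obstruction embeds Z into the carrier of another minimal
   obstruction, which cannot be longer, so g splits. *)
Lemma left_almost_split_obstruction (R : comPzRingType) (A : algType R)
    n (O : lmodType A) (io : {linear O -> 'rV[A]_n}) :
  artin_algebra A -> fin_gen O -> ~ extends io idfun ->
  exists (Z : lmodType A) (phi : {linear O -> Z}),
    [/\ fin_gen Z, minimal_obstruction io phi
      & forall (Y : lmodType A) (g : {linear Z -> Y}), fin_gen Y ->
          ~ split_mono g -> extends io (g \o phi)].
Proof.
move=> hA fO nid.
have [k hk] := minimal_obstruction_series io hA fO.
pose cand l := `[< exists (Z : lmodType A) (phi : {linear O -> Z}),
  [/\ fin_gen Z, minimal_obstruction io phi & strict_chain Z l] >].
have ex : exists l, cand l.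
  have [r rO] := artin_ranked hA fO.
  have [Q [q [qs mq]]] := minimal_quotient rO nid.
  exists 0%N; apply/asboolP; exists Q, (q \o idfun); split=> //.
    exact: fin_gen_surj fO.
  by exists (fun=> setT); split=> // i; apply: submodule_setT.
have ub l : cand l -> (l <= k)%N.
  move=> /asboolP [Z [phi [fZ mZ [S [hS cS]]]]].
  have rZ := series_ranked (hk Z phi mZ).
  exact: (ranked_chain rZ (S := S) (fun i => submodule_restr (hS i)) cS).
case: (ex_maxnP ex ub) => l /asboolP [Z [phi [fZ mZ [S [hS cS]]]]] maxl.
exists Z, phi; split=> // Y g fY nsg; apply: contrapT => nex.
have [r rY] := artin_ranked hA fY.
have [Q [q [qs mq]]] := minimal_quotient rY nex.
have ui : injective (q \o g).
  apply: ker0_inj => z z0; apply: contrapT => nz.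
  have [||h hh] := mZ.2 [set x | (q \o g) x = 0].
  - exact: submodule_ker.
  - by exists z.
  apply: mq.1; exists (q \o (g \o h)) => x.
  by apply/esym/eqP; rewrite -subr_eq0; have := hh x; rewrite /= !linearB => ->.
(* If q g were not onto, the image of the longest chain followed by all of Q would be a longer chain
   in a minimal obstruction. *)
have us y : exists x, (q \o g) x = y.
  apply: contrapT => ny.
  have : cand l.+1; last by move=> /maxl; rewrite ltnn.
  apply/asboolP; exists Q, (q \o (g \o phi)); split=> //.
    exact: fin_gen_surj fY.
  exists (fun i => if (i <= l)%N then (q \o g) @` S i else setT); split=> [i|i il].
    by case: ifP => _; [apply: submodule_im|apply: submodule_setT].
  rewrite -ltnS il; case: ltnP => li.
    have [s1 s2] := cS i li; split; first exact: image_subset.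
    move=> h; apply: s2 => x Sx; have [|z Sz /ui <-] := h ((q \o g) x); last by [].
    by exists x.
  split=> // h; apply: ny; have [x _ <-] := h y Logic.I; by exists x.
have [w [uK _]] := bij_linv (inj_surj_bij ui us).
by apply: nsg; exists (w \o q).
Qed.

(** If both factors of Z = X x Y were nonzero, the class would vanish in each projection, and the
    two extensions combine into one with values in Z. *)
Lemma minimal_obstruction_indecomposable (A : pzRingType) (F O Z : lmodType A)
    (io : {linear O -> F}) (phi : {linear O -> Z}) :
  minimal_obstruction io phi -> indecomposable Z.
Proof.
move=> [nex min]; split.
  by move=> zZ; apply: nex; exists \0 => x; rewrite [RHS]zZ.
move=> X Y [f bf]; have [g [fK gK]] := bij_linv bf.
apply: contrapT => /not_orP [nX nY].
pose p1 : {linear Z -> X} := (fst : {linear (X * Y)%type -> X}) \o f.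
pose p2 : {linear Z -> Y} := (snd : {linear (X * Y)%type -> Y}) \o f.
have nz (T : lmodType A) : ~ zero_mod T -> exists x : T, x <> 0.
  by move=> h; apply: contrapT => h'; apply: h => x; apply: contrapT => nx;
    apply: h'; exists x.
have [y ny] := nz Y nY; have [x nx] := nz X nX.
have [||h1 hh1] := min [set z | p1 z = 0].
- exact: submodule_ker.
- exists (g (0, y)); split; first by rewrite /= /p1 /= gK.
  by move=> /(congr1 f); rewrite gK linear0 => -[].
have [||h2 hh2] := min [set z | p2 z = 0].
- exact: submodule_ker.
- exists (g (x, 0)); split; first by rewrite /= /p2 /= gK.
  by move=> /(congr1 f); rewrite gK linear0 => -[].
apply: nex.
have l : linear (fun u : F => (p1 (h1 u), p2 (h2 u)) : (X * Y)%type).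
  by move=> a u v; rewrite !linearP.
exists (g \o linear_of l) => u; rewrite -[RHS]fK /=; congr (g _).
have /eqP := hh1 u; have /eqP := hh2 u.
rewrite /= !linearB !subr_eq0 => /eqP <- /eqP <-.
by rewrite /p1 /p2 /=; case: (f (phi u)).
Qed.

Definition almost_split (A : pzRingType) (K E N : lmodType A)
    (i : {linear K -> E}) (f : {linear E -> N}) : Prop :=
  [/\ ~ split_mono i, ~ split_epi f,
      (forall x, f x = 0 <-> exists z, i z = x)
    , forall (Y : lmodType A) (g : {linear K -> Y}), fin_gen Y ->
        ~ split_mono g -> exists h : {linear E -> Y}, forall x, h (i x) = g x
    & forall (X : lmodType A) (h : {linear X -> N}), fin_gen X ->
        ~ split_epi h -> exists g : {linear X -> E}, forall x, f (g x) = h x].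

Lemma almost_split_exists (R : comPzRingType) (A : algType R)
    (X N : lmodType A) (p : {linear X -> N}) :
  artin_algebra A -> fin_gen N -> indecomposable N ->
  (forall y, exists x, p x = y) -> ~ split_epi p ->
  exists (K E : lmodType A) (i : {linear K -> E}) (f : {linear E -> N}),
    [/\ [/\ fin_gen K, fin_gen E & indecomposable K], injective i,
        (forall y, exists x, f x = y) & almost_split i f].
Proof.
move=> hA fN iN ps nsp.
have [n [pi pis]] := row_cover fN.
have nspi : ~ split_epi pi.
  move=> [s sK]; have [h hh] := row_lift pi ps.
  by apply: nsp; exists (h \o s) => y; rewrite /= hh sK.
have [O [io [ioi hio]]] := sub_exists (submodule_ker pi).
have [r rF] := artin_ranked hA (row_fin_gen A n).
have fO : fin_gen O by apply: fin_gen_inj rF ioi.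
have nid : ~ extends io idfun.
  move=> [h hh].
  have [|s hs] := factor_surj (g := idfun \- (io \o h)) pis.
    move=> x x0; have [w <-] : exists w, io w = x by apply/hio.
    by rewrite /= hh subrr.
  apply: nspi; exists s => y; have [x <-] := pis y; rewrite hs /= linearB.
  have : [set x | pi x = 0] (io (h x)) by apply/hio; exists (h x).
  by move=> /= ->; rewrite subr0.
have [Z [phi [fZ mZ las]]] := left_almost_split_obstruction hA fO nid.
have iZ := minimal_obstruction_indecomposable mZ.
(* E is the pushout of [io] along [phi], that is, the extension of N by Z whose class is that of
   [phi]. *)
have lP : linear (fun w : O => (phi w, - io w) : (Z * 'rV[A]_n)%type).
  by move=> a u v; congr pair; rewrite /= linearP // opprD scalerN.
have [E [q [qs hq]]] := quot_exists (submodule_im (linear_of lP) (submodule_setT O)).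
have l1 : linear (fun z : Z => (z, 0) : (Z * 'rV[A]_n)%type).
  by move=> a x y; congr pair; rewrite /= scaler0 addr0.
have l2 : linear (fun z : 'rV[A]_n => (0, z) : (Z * 'rV[A]_n)%type).
  by move=> a x y; congr pair; rewrite /= scaler0 addr0.
pose i : {linear Z -> E} := q \o linear_of l1.
pose j : {linear 'rV[A]_n -> E} := q \o linear_of l2.
have ij u : exists z x, u = i z + j x.
  have [[z x] <-] := qs u; exists z, x; rewrite /i /j /= -linearD; congr (q _).
  by congr pair; rewrite /= ?addr0 ?add0r.
have iphi w : i (phi w) = j (io w).
  apply/eqP; rewrite -subr_eq0 /i /j /= -linearB; apply/eqP/hq.
  by exists w => //; rewrite linear_ofE; congr pair; rewrite /= ?subr0 ?sub0r.
have ii : injective i.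
  apply: ker0_inj => z /hq [w _ [<- e]].
  have -> : w = 0 by apply: ioi; rewrite linear0; apply/eqP; rewrite -oppr_eq0 e.
  by rewrite linear0.
have [|f hf] := factor_surj (p := q) (g :=
  pi \o (snd : {linear (Z * 'rV[A]_n)%type -> 'rV[A]_n})) qs.
  move=> u /hq [w _ <-] /=; rewrite linearN.
  have : [set x | pi x = 0] (io w) by apply/hio; exists w.
  by move=> /= ->; rewrite oppr0.
have fi z : f (i z) = 0 by rewrite /i /= hf /= linear0.
have fj x : f (j x) = pi x by rewrite /j /= hf.
have fs y : exists u, f u = y by have [x <-] := pis y; exists (j x).
have kerf u : f u = 0 <-> exists z, i z = u.
  split=> [|[z <-]] //; have [z [x ->]] := ij u; rewrite linearD fi add0r fj => x0.
  have [w <-] : exists w, io w = x by apply/hio.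
  by exists (z + phi w); rewrite linearD iphi.
have fE : fin_gen E.
  apply: fin_gen_surj qs _; apply: fin_gen_prod fZ _; exact: row_fin_gen.
have nsi : ~ split_mono i.
  move=> [s sK]; apply: mZ.1; exists (s \o j) => w.
  by rewrite -[RHS]sK iphi.
have lasi (Y : lmodType A) (g : {linear Z -> Y}) : fin_gen Y ->
    ~ split_mono g -> exists h : {linear E -> Y}, forall x, h (i x) = g x.
  move=> fY ng; have [h hh] := las Y g fY ng.
  have l : linear (fun u : (Z * 'rV[A]_n)%type => g u.1 + h u.2).
    by move=> a [x y] [x' y']; rewrite /= !linearP scalerDr addrACA.
  have [|e he] := factor_surj (p := q) (g := linear_of l) qs.
    move=> u /hq [w _ <-]; rewrite linear_ofE /= linearN hh /=.
    by rewrite subrr.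
  by exists e => x; rewrite /i /= he linear_ofE /= linear0 addr0.
have nsf : ~ split_epi f.
  move=> [s sK].
  have [|t ht] := factor_inj (i := i) (g := idfun \- (s \o f)) ii.
    by move=> u; apply/kerf; rewrite /= linearB sK subrr.
  apply: nsi; exists t => z; apply: ii.
  by rewrite ht /= fi linear0 subr0.
exists Z, E, i, f; split=> //; split=> // X' h fX nh.
(* If the pulled back sequence does not split then it is the target of a
   morphism of extensions that is the identity on Z. *)
pose D := [set u : (E * X')%type | f u.1 = h u.2].
have hD : submodule D.
  split; first by rewrite /D /= !linear0.
  by move=> a [u x] [v y]; rewrite /D /= => e e'; rewrite !linearP e e'.
have [W [d [di hd]]] := sub_exists hD.
have [rE rkE] := artin_ranked hA (fin_gen_prod fE fX).
have fW : fin_gen W by apply: fin_gen_inj rkE di.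
pose d1 : {linear W -> E} := (fst : {linear (E * X')%type -> E}) \o d.
pose d2 : {linear W -> X'} := (snd : {linear (E * X')%type -> X'}) \o d.
have fd w : f (d1 w) = h (d2 w) by apply: (hd (d w)).2; exists w.
have lz : linear (fun z : Z => (i z, 0) : (E * X')%type).
  by move=> a x y; congr pair; [exact: linearP | rewrite /= scaler0 addr0].
have [|c hc] := factor_inj (i := d) (g := linear_of lz) di.
  by move=> z; apply/hd; rewrite /D /= fi linear0.
have [[s sK]|nc] := pselect (split_mono c).
  have d2s x : exists w, d2 w = x.
    have [u fu] := fs (h x); have /hd [w hw] : D (u, x) by [].
    by exists w; rewrite /d2 /= hw.
  have [|g hg] := factor_surj (p := d2) (g := d1 \- (i \o s)) d2s.
    move=> w w0; have /kerf [z hz] : f (d1 w) = 0 by rewrite fd w0 linear0.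
    have -> : w = c z.
      apply: di; rewrite hc linear_ofE hz.
      by move: w0; rewrite /d1 /d2 /=; case: (d w) => u x /= ->.
    by rewrite /= sK /d1 /= hc /= subrr.
  by exists g => x; have [w <-] := d2s x; rewrite hg /= linearB fi subr0 -fd.
have [m hm] := lasi W c fW nc.
pose m1 : {linear E -> E} := d1 \o m.
have m1i z : m1 (i z) = i z by rewrite /m1 /= hm /d1 /= hc.
have [|v hv] := factor_surj (p := f) (g := d2 \o m) fs.
  by move=> u /kerf [z <-]; rewrite /= hm /d2 /= hc.
have fm u : f (m1 u) = (h \o v) (f u) by rewrite /m1 /= hv fd.
have [rN rkN] := artin_ranked hA fN.
(* If h v is bijective then h splits. If it is nilpotent, a power of m1 maps E into the image of i
   while fixing that image pointwise, which gives a retraction of i. *)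
have [be|[k hk]] := bij_or_nilpotent iN rkN (h \o v).
  have [w [_ wK]] := bij_linv be.
  by exfalso; apply: nh; exists (v \o w).
have fmk u : f (iter k m1 u) = 0.
  rewrite -(hk (f u)); elim: k {hk} => // k IH.
  by rewrite [in LHS]iterS fm IH.
have [|t ht] := factor_inj (i := i) (g := linear_of (iter_linear m1 k)) ii.
  by move=> u; apply/kerf; apply: fmk.
exfalso; apply: nsi; exists t => z; apply: ii; rewrite ht linear_ofE.
by elim: k {hk fmk t ht} => // k IH; rewrite iterS IH m1i.
Qed.

(** * Irreducible maps read off from an almost split sequence *)

Lemma irreducible_comp_bij (A : pzRingType) (K M N : lmodType A)
    (g : {linear M -> N}) (u : {linear K -> M}) :
  bijective u -> irreducible_map g -> irreducible_map (g \o u).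
Proof.
move=> /bij_linv [v [uK vK]] [nsm nse fac]; split.
- move=> [r rK]; apply: nsm; exists (u \o r) => x.
  by rewrite -[in LHS](vK x) /= (rK (v x)) vK.
- by move=> [s sK]; apply: nse; exists (u \o s).
- move=> X k h fX e; have [|[r rK]|] := fac X (k \o v) h fX; [|left|by right].
    by move=> x; rewrite /= -e /= vK.
  exists (v \o r) => x; rewrite -[in LHS](uK x) /=.
  by have := rK (u x); rewrite /= => ->; rewrite uK.
Qed.

Section AlmostSplit.
Variables (A : pzRingType) (K E N : lmodType A).
Variables (i : {linear K -> E}) (f : {linear E -> N}).
Hypotheses (indK : indecomposable K) (indN : indecomposable N).
Hypotheses (ii : injective i) (fs : forall y, exists x, f x = y).
Hypothesis as_if : almost_split i f.

(** Apply Fitting's lemma to the endomorphism induced on K: if it is nilpotent, a power of phi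
    factors through f and yields a section; otherwise phi is bijective on both K and N, hence on
    E. *)
Lemma almost_split_right_minimal n (phi : {linear E -> E}) :
  ranked K n -> (forall x, f (phi x) = f x) -> bijective phi.
Proof.
move=> rK hphi; have [nsi nsf kerf _ _] := as_if.
have fi z : f (i z) = 0 by apply/kerf; exists z.
have [|psi hpsi] := factor_inj (i := i) (g := phi \o i) ii.
  by move=> z; apply/kerf; rewrite /= hphi fi.
have [bpsi|[k hk]] := bij_or_nilpotent indK rK psi.
  have [w [wK Kw]] := bij_linv bpsi.
  apply: inj_surj_bij => [|u].
    apply: ker0_inj => u u0.
    have /kerf [z hz] : f u = 0 by rewrite -hphi u0 linear0.
    have : psi z = 0 by apply: ii; rewrite hpsi /= hz u0 linear0.
    by rewrite -hz => /(congr1 w); rewrite wK linear0 => ->; rewrite linear0.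
  have /kerf [z hz] : f (phi u - u) = 0 by rewrite linearB hphi subrr.
  exists (u - i (w z)); rewrite linearB.
  have := hpsi (w z); rewrite /= Kw => <-.
  by rewrite hz opprB addrC subrK.
have iterphi u : f (iter k phi u) = f u.
  by elim: k {hk} => // k IH; rewrite iterS hphi.
have iteri z : iter k phi (i z) = i (iter k psi z).
  by elim: k {hk iterphi} => // k IH; rewrite !iterS IH hpsi.
have [|s hs] := factor_surj (p := f) (g := linear_of (iter_linear phi k)) fs.
  by move=> u /kerf [z <-]; rewrite linear_ofE iteri hk linear0.
exfalso; apply: nsf; exists s => y; have [u <-] := fs y.
by rewrite hs linear_ofE iterphi.
Qed.

Lemma almost_split_left_minimal n (phi : {linear E -> E}) :
  ranked N n -> (forall z, phi (i z) = i z) -> bijective phi.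
Proof.
move=> rN hphi; have [nsi nsf kerf _ _] := as_if.
have fi z : f (i z) = 0 by apply/kerf; exists z.
have [|e he] := factor_surj (p := f) (g := f \o phi) fs.
  by move=> u /kerf [z <-]; rewrite /= hphi fi.
have [be|[k hk]] := bij_or_nilpotent indN rN e.
  have [w [wK Kw]] := bij_linv be.
  apply: inj_surj_bij => [|u].
    apply: ker0_inj => u u0.
    have : e (f u) = 0 by rewrite he /= u0 linear0.
    move=> /(congr1 w); rewrite wK linear0 => /kerf [z hz].
    by rewrite -hz -hphi hz.
  have [v hv] := fs (w (f u)).
  have /kerf [z hz] : f (u - phi v) = 0.
    have /= := he v; rewrite hv Kw => e1.
    by rewrite linearB -e1 subrr.
  by exists (v + i z); rewrite linearD hphi hz addrC subrK.
have iterphi u : f (iter k phi u) = 0.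
  by rewrite -(hk (f u)); elim: k {hk} => // k IH; rewrite [in RHS]iterS -IH he.
have [|t ht] := factor_inj (i := i) (g := linear_of (iter_linear phi k)) ii.
  by move=> u; apply/kerf; apply: iterphi.
exfalso; apply: nsi; exists t => z; apply: ii; rewrite ht linear_ofE.
by elim: k {hk iterphi t ht} => // k IH; rewrite iterS IH hphi.
Qed.

Variables (I : indcat A) (J : finType) (F : J -> I).
Variables (a : forall t, {linear E -> ind_mod (F t)}).
Variables (b : forall t, {linear ind_mod (F t) -> E}).
Hypothesis dec : decomposes a b.

Lemma almost_split_irreducible_right n (s : J) :
  ranked K n -> irreducible_map (f \o b s).
Proof.
move=> rK; have [d1 d2 d3] := dec; have [nsi nsf _ _ ras] := as_if.
have [nzs _] := ind_indecomposable (F s).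
split.
- move=> /(split_mono_bij indN nzs) /bij_linv [w [_ wK]].
  by apply: nsf; exists (b s \o w).
- by move=> [w wK]; apply: nsf; exists (b s \o w).
move=> X g h fX e.
have [|nh] := pselect (split_epi h); [by right|left].
have [k hk] := ras X h fX nh.
pose rest := linear_of (sum_linear (index_enum J) [pred t | t != s]
  (fun t => b t \o a t : {linear E -> E})).
(* The identity of E with its component through [F s] rerouted through g and the lift k of h. As f
   phi = f, phi is invertible, and a_s phi^-1 k is a retraction of g. *)
pose phi : {linear E -> E} := rest \+ (k \o (g \o a s)).
have /(almost_split_right_minimal rK) /bij_linv [w [wK _]] x : f (phi x) = f x.
  rewrite -[in RHS](d1 x) (bigD1 s) //= !linearD addrC hk -e.
  by congr (_ + _).
exists (a s \o (w \o k)) => x /=.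
rewrite -[RHS](d2 s) -[b s x in RHS]wK /= big1 ?add0r ?d2 //.
by move=> t /eqP ts /=; rewrite d3 ?linear0.
Qed.

Lemma almost_split_irreducible_left n (s : J) :
  ranked N n -> irreducible_map (a s \o i).
Proof.
move=> rN; have [d1 d2 d3] := dec; have [nsi nsf _ las _] := as_if.
have [nzs _] := ind_indecomposable (F s).
split.
- by move=> [w wK]; apply: nsi; exists (w \o a s).
- move=> /(split_epi_bij indK nzs) /bij_linv [w [wK _]].
  by apply: nsi; exists (w \o a s).
move=> X g h fX e.
have [|ng] := pselect (split_mono g); [by left|right].
have [m hm] := las X g fX ng.
pose rest := linear_of (sum_linear (index_enum J) [pred t | t != s]
  (fun t => b t \o a t : {linear E -> E})).
pose phi : {linear E -> E} := rest \+ (b s \o (h \o m)).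
have /(almost_split_left_minimal rN) /bij_linv [w [_ wK]] z : phi (i z) = i z.
  rewrite -[in RHS](d1 (i z)) (bigD1 s) //= addrC hm -e.
  by congr (_ + _).
exists (m \o (w \o b s)) => x /=.
rewrite -[RHS](d2 s) -[b s x in RHS]wK /= linearD d2 linear_sum big1 ?add0r //.
by move=> t /eqP ts /=; rewrite d3 //; apply/nesym.
Qed.
End AlmostSplit.

(** * Arrows between layers *)

Lemma dirsum_components (A : pzRingType) (I : indcat A) (M : lmodType A) n
    (F : 'I_n -> I) (h : {linear dirsum (fun k => ind_mod (F k)) -> M}) :
  exists e : 'I_n -> {linear dirsum (fun k => ind_mod (F k)) -> M},
    (forall v, h v = \sum_k e k v) /\
    forall k, exists (p : {linear dirsum (fun k => ind_mod (F k)) -> ind_mod (F k)})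
      (f : {linear ind_mod (F k) -> M}), forall v, e k v = f (p v).
Proof.
elim: n F h => [|n IH] F.
  rewrite /dirsum big_ord0 => h; exists (fun=> \0); split=> [v|[]] //.
  by rewrite big_ord0 (_ : v = 0) ?linear0 //; apply/rowP => -[].
rewrite /dirsum big_ord_recl -/(dirsum (fun k => ind_mod (F (lift ord0 k)))).
set D := dirsum _; move=> h.
have l2 : linear (fun y : D => (0, y) : (ind_mod (F ord0) * D)%type).
  by move=> a x y; congr pair; rewrite /= scaler0 addr0.
have l1 : linear (fun x => (x, 0) : (ind_mod (F ord0) * D)%type).
  by move=> a x y; congr pair; rewrite /= scaler0 addr0.
have [e [he hf]] := IH _ (h \o linear_of l2).
pose p1 : {linear (ind_mod (F ord0) * D)%type -> ind_mod (F ord0)} := fst.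
pose p2 : {linear (ind_mod (F ord0) * D)%type -> D} := snd.
exists (fun k => if unlift ord0 k is Some j
  then e j \o p2 : {linear _ -> _} else (h \o linear_of l1) \o p1 : {linear _ -> _}).
split=> [[x y]|k].
  rewrite big_ord_recl unlift_none /=.
  under eq_bigr do rewrite liftK /=.
  rewrite -he /= -linearD; congr (h _).
  by congr pair; rewrite /= ?addr0 ?add0r.
case: (unliftP ord0 k) => [j ->|->].
  have [p [f pf]] := hf j.
  by exists (p \o p2), f => v; rewrite /= pf.
by exists p1, (h \o linear_of l1).
Qed.

(** The identity of N is a sum of endomorphisms through the [F k]; by locality one of them is
    bijective and makes N a summand of the indecomposable [F k]. *)
Lemma dirsum_split_epi (A : pzRingType) (I : indcat A) (N : I) n r (F : 'I_n -> I)
    (h : {linear dirsum (fun k => ind_mod (F k)) -> ind_mod N}) :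
  ranked (ind_mod N) r -> split_epi h -> exists k, F k = N.
Proof.
move=> rN [s sK]; have [e [he hf]] := dirsum_components h.
have iN := ind_indecomposable N.
have [k bk] : exists k, bijective (e k \o s).
  apply: contrapT => nb.
  apply: (sum_nonbij iN rN (r := index_enum _) (e := fun k => e k \o s)).
    by move=> k bk; apply: nb; exists k.
  by apply: (eq_bij (f := id)) => [|x]; [exists id | rewrite -[LHS]sK he].
exists k; have [p [f pf]] := hf k.
have /bij_linv [w [_ wK]] : bijective (f \o (p \o s)).
  by apply: (eq_bij bk) => x; rewrite /= pf.
apply: (bij_ind_eq (f := f)).
apply: split_epi_bij; [exact: ind_indecomposable|exact: iN.1|].
by exists ((p \o s) \o w).
Qed.

(** Supplies the non-split epimorphism that [almost_split_exists] starts from: the cover of N by P_0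
    cannot split, since N would then lie in P_0. *)
Lemma nonprojective_layer (R : comPzRingType) (A : algType R) (I : indcat A)
    (P : natinf -> set I) (N : I) j :
  artin_algebra A -> postprojective_partition P -> P (Fin j) N -> (0 < j)%N ->
  exists (X : lmodType A) (p : {linear X -> ind_mod N}),
    (forall y, exists x, p x = y) /\ ~ split_epi p.
Proof.
move=> hA hP PN j0.
have [_ _ /(_ 0%N) [_ [[_ cov] _]]] := hP.
have [|X [[n [F [PF [s [r sK]]]]] [f sf]]] := cov N; first by exists (Fin j).
exists (dirsum (fun k => ind_mod (F k))), (f \o r); split=> [y|se].
  by have [x _ <-] := sf y Logic.I; exists (s x); rewrite /= sK.
have [l rl] := artin_ranked hA (ind_fin_gen N).
have [k FkN] := dirsum_split_epi rl se.
have := layer_disjoint hP PN; rewrite -FkN => /(_ _ (PF k)) [e].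
by rewrite e in j0.
Qed.

(** The component enters through closure under predecessors: the induction passes from N to a
    summand of E, which has an arrow to N. *)
Lemma no_skipping_arrow (R : comPzRingType) (A : algType R) (I : indcat A)
    (P : natinf -> set I) (G : set I) :
  artin_algebra A -> postprojective_partition P ->
  (forall X Y, @AR_arrow A I X Y -> G Y -> G X) -> P_discrete P G ->
  forall i j (M N : I), G N -> AR_arrow M N -> P (Fin i) M -> P (Fin j) N ->
    ~ (i.+1 < j)%N.
Proof.
move=> hA hP closed disc; elim/ltn_ind => i IH j M N GN [f0 irr0] PM PN ij.
have [X [p [ps np]]] := nonprojective_layer hA hP PN (leq_ltn_trans (leq0n _) ij).
have iN := ind_indecomposable N; have fgN := ind_fin_gen N.
have [K [E [i0 [f [[fK fE iK] ii fs ass]]]]] := almost_split_exists hA fgN iN ps np.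
have [nsi nsf kerf las ras] := ass.
have [rK rkK] := artin_ranked hA fK; have [rN rkN] := artin_ranked hA fgN.
have [rE rkE] := artin_ranked hA fE.
have [J [F [a [b dec]]]] := decomposition I fE rkE.
have irrR t : irreducible_map (f \o b t) :=
  almost_split_irreducible_right iK iN ii fs ass dec t rkK.
have irrL t : irreducible_map (a t \o i0) :=
  almost_split_irreducible_left iK iN ii fs ass dec t rkN.
have GF t : G (F t) by apply: closed GN; exists (f \o b t).
have [d1 d2 d3] := dec.
have toN l X' (g : {linear ind_mod X' -> ind_mod N}) :
    P l X' -> l <> Fin j -> ~ split_epi g.
  move=> PX lj se; apply: lj; apply: layer_disjoint hP PX _.
  suff -> : X' = N by [].
  apply: (bij_ind_eq (f := g)).
  by apply: split_epi_bij se; [exact: ind_indecomposable | exact: iN.1].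
(* P_{k+1} generates every later layer, so the trace of P_l with l > k lies in that of P_{k+1}, to
   which P-discreteness applies. *)
have collapse t k l y : P (Fin k) (F t) -> (k < l)%N ->
    trace (P (Fin l)) (ind_mod (F t)) y -> trace (P Infty) (ind_mod (F t)) y.
  move=> PF kl; rewrite -(disc k _ (GF t) PF); apply: trace_trans => Y PY.
  by apply: layer_trace hP _; exists (Fin l).
(* A map from P_{j-1} to N is a sum of pieces through the [F t]. In layers from j on, f b_t is
   itself a non-bijective map; in layers below j-1, [collapse] replaces the piece by maps from
   P_oo. *)
have [L PL] : exists L, P (Fin j.-1) (F L).
  apply: contrapT => noL; apply: (layer_splitting hA hP PN) => x.
  set T := @nonsplit_trace _ _ _ N; have hT : submodule T by apply: submodule_smallest.
  have jK : j.-1.+1 = j by apply: prednK; apply: leq_trans ij.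
  have : trace (P (Fin j.-1)) (ind_mod N) x.
    by apply: layer_trace hP _ x; exists (Fin j) => //=; apply: leq_pred.
  apply: (trace_sub hT) => X' g y PX.
  have [|g' hg] := ras _ g (ind_fin_gen X').
    apply: toN PX _ => -[e]; by move: jK; rewrite e => /eqP; rewrite eqn_leq ltnn.
  rewrite -hg -(d1 (g' y)) linear_sum.
  apply: (@submodule_sum _ _ T _ _ xpredT _ hT) => t _;
    have [k Pk] := layer_exists (F t) hP.
  have [jk|jk] := pselect (le_natinf j k).
    apply: smallest_gen; exists (F t), (f \o b t), (a t (g' y)); split=> //.
      by exists k.
    move=> bft; have [_ nse _] := irrR t; apply: nse.
    by have [w [_ wK]] := bij_linv bft; exists w.
  case: k Pk jk => [k|] Pk jk; last by case: jk.
  have kj : (k < j.-1)%N.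
    rewrite ltn_neqAle; apply/andP; split.
      by apply/eqP => e; apply: noL; exists t; rewrite -e.
    by rewrite -ltnS jK ltnNge; apply/negP.
  have : trace (P Infty) (ind_mod (F t)) (a t (g' y)).
    by apply: collapse Pk kj _; exact: (trace_mem (a t \o g') y PX).
  apply: (trace_sub (submodule_preim (f \o b t) hT)) => W u z PW;
    apply: smallest_gen; exists W, ((f \o b t) \o u), z; split=> //.
    by exists Infty.
  move=> /bij_linv [w [_ wK]]; apply: (toN _ _ ((f \o b t) \o u) PW) => //.
  by exists w.
have [k0 hk0] : exists k0 : {linear ind_mod M -> E}, forall x, f (k0 x) = f0 x.
  by apply: ras; [exact: ind_fin_gen|case: irr0].
(* Since f is not split, irreducibility of f0 = f k0 makes k0 a split monomorphism; locality of End
   M then finds a summand isomorphic to M, which is M by skeletality. *)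
have [s0 Es0] : exists s, M = F s.
  have [_ nse fac] := irr0.
  have [|[r hr]|//] := fac E k0 f fE; first by move=> x; rewrite hk0.
  have iM := ind_indecomposable M.
  have [rM rkM] := artin_ranked hA (ind_fin_gen M).
  have [t bt] : exists t, bijective ((r \o b t) \o (a t \o k0)).
    apply: contrapT => nb.
    apply: (sum_nonbij iM rkM (r := index_enum _)
      (e := fun t => (r \o b t) \o (a t \o k0))).
      by move=> t bt; apply: nb; exists t.
    apply: (eq_bij (f := id)) => [|x]; first by exists id.
    by rewrite -[LHS]hr -[in LHS](d1 (k0 x)) linear_sum.
  exists t; apply: (bij_ind_eq (f := a t \o k0)).
  apply: split_mono_bij; [exact: ind_indecomposable|exact: iM.1|].
  by have [w [wK _]] := bij_linv bt; exists (w \o (r \o b t)).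
subst M.
have [U [th bth]] := ind_dense I fK iK; have [th' [thK thK']] := bij_linv bth.
have bth' : bijective th' by exists th.
have irrU t : irreducible_map ((a t \o i0) \o th').
  exact: irreducible_comp_bij bth' (irrL t).
have nU : ~ layers_from P i U.
  move=> hU; apply: (layer_splitting hA hP PM) => m.
  set T := @nonsplit_trace _ _ _ (F s0);
    have hT : submodule T by apply: submodule_smallest.
  have toM e : trace (P (Fin i.+1)) (ind_mod (F s0)) e -> T e.
    rewrite (disc i _ (GF s0) PM); apply: (trace_sub hT) => W u z PW.
    apply: smallest_gen; exists W, u, z; split=> //; first by exists Infty.
    move=> /bij_ind_eq e'; rewrite e' in PW.
    by have := layer_disjoint hP PW PM.
  have : trace (P (Fin i.+1)) (ind_mod N) (f (b s0 m)).
    by apply: layer_trace hP _ _; exists (Fin j) => //=; apply: ltnW.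
  have hS : submodule (f @` (a s0 @^-1` T)) by apply: submodule_im;
    apply: submodule_preim.
  move=> /(trace_sub hS) [].
    move=> X' g y PX.
    have [|g' hg] := ras _ g (ind_fin_gen X').
      apply: toN PX _ => -[e]; by move: ij; rewrite e ltnn.
    exists (g' y) => //; apply: toM; exact: (trace_mem (a s0 \o g') y PX).
  (* Since f (b m) = f e, the difference b m - e comes from some z in K. Applying a, m is the sum of
     a e, which is in T, and the image of z under the irreducible map K -> M. *)
  move=> e Te fe.
  have /kerf [z hz] : f (b s0 m - e) = 0 by rewrite linearB fe subrr.
  rewrite -(d2 s0 m) -(subrK e (b s0 m)) -hz linearD; apply: (submoduleD hT) => //.
  apply: smallest_gen; exists U, ((a s0 \o i0) \o th'), (th z); split=> //.
    move=> bu; have [_ nse _] := irrU s0; apply: nse.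
    by have [w [_ wK]] := bij_linv bu; exists w.
  by rewrite /= thK.
have [[l|] PU] := layer_exists U hP; last by apply: nU; exists Infty.
have li : (l < i)%N.
  by rewrite ltnNge; apply/negP => il; apply: nU; exists (Fin l).
apply: (IH l li j.-1 U (F L)) => //.
- by exists ((a L \o i0) \o th').
- by rewrite -(ltn_predRL) in ij; apply: leq_ltn_trans ij.
Qed.

Theorem theorem2p3 (R : comPzRingType) (A : algType R)
    (hartin : artin_algebra A) (hbasic : basic A)
    (I : indcat A) (hinf : rep_infinite I)
    (P : natinf -> set I) (hP : postprojective_partition P)
    (G : set I) (hG : AR_component G) (hdisc : P_discrete P G) :
  ~ exists (M N : I) (i j : nat),
      [/\ G M /\ G N, AR_arrow M N, P (Fin i) M, P (Fin j) N & (i.+1 < j)%N].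
Proof.
move=> [M [N [i [j [[_ GN] MN PM PN]]]]].
apply: (no_skipping_arrow hartin hP _ hdisc GN MN PM PN).
case: hG => M0 -> X Y XY M0Y; apply: rst_trans M0Y _.
by apply: rst_sym; apply: rst_step.
Qed.
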